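(* Let $A$ and $B$ be self-similar sets (in possibly different Euclidean spaces) with the strong separation condition (SSC) such that $A$ is homogeneous. Suppose that $\dim_H A=\dim_H B$. Then $A$ can be mapped onto $B$ by a Lipschitz map if and only if $A$ and $B$ are bilipschitz equivalent.
   Context: $\dim_H$ denotes Hausdorff dimension. A self-similar set is a nonempty compact $K\subset\mathbb{R}^n$ with $K=\bigcup_{i=1}^m f_i(K)$ for finitely many contracting similarity maps $f_1,\dots,f_m$ of $\mathbb{R}^n$; it satisfies the SSC if $f_i(K)\cap f_j(K)=\emptyset$ for all $1\le i<j\le m$, and it is homogeneous if all the maps $f_i$ have the same similarity ratio. (''Homogeneous with the SSC'' means that both properties hold for the same system of maps.) A map $f$ between metric spaces is Lipschitz if there is a finite $C$ with $d(f(x),f(z))\le C\,d(x,z)$ for all $x,z$ in its domain. Two metric spaces are bilipschitz equivalent if there is a bijection between them such that both it and its inverse are Lipschitz. *)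

(* Defs.v *)
From HB Require Import structures.
From mathcomp Require Import all_boot all_order all_algebra.
From mathcomp Require Import all_classical all_reals all_analysis.
Import Order.TTheory GRing.Theory Num.Theory.
Import numFieldNormedType.Exports.

Set Implicit Arguments.
Unset Strict Implicit.
Unset Printing Implicit Defensive.

Local Open Scope classical_set_scope.
Local Open Scope ring_scope.

Section Euclidean.
Context {R : realType}.

(* The library's norm on 'rV[R]_n is the sup norm, hence the explicit Euclidean
   distance. Both induce the same topology, so the library's [compact] is
   compactness in Euclidean space. *)
Definition edist n (x y : 'rV[R]_n) : R :=
  Num.sqrt (\sum_(i < n) (x ord0 i - y ord0 i) ^+ 2).

(* The [maxe 0] only matters for the empty set, whose diameter is 0. *)
Definition ediam n (U : set 'rV[R]_n) : \bar R :=
  maxe 0%E (ereal_sup [set (edist x y)%:E | x in U & y in U]).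

(* |U|^s, with |set0|^s = 0 for every s; in particular, for s = 0 a nonempty
   set has weight 1 and the empty set has weight 0. *)
Definition diam_pow n (s : R) (U : set 'rV[R]_n) : \bar R :=
  if `[< U = set0 >] then 0%E else poweR (ediam U) s.

Definition delta_cover n (delta : R) (E : set 'rV[R]_n)
    (U : nat -> set 'rV[R]_n) : Prop :=
  E `<=` \bigcup_k U k /\ forall k, (ediam (U k) <= delta%:E)%E.

Definition hausdorff_premeasure n (s delta : R) (E : set 'rV[R]_n) : \bar R :=
  ereal_inf [set (\sum_(0 <= k <oo) diam_pow s (U k))%E
            | U in delta_cover delta E].

Definition hausdorff_measure n (s : R) (E : set 'rV[R]_n) : \bar R :=
  ereal_sup [set hausdorff_premeasure s delta E
            | delta in [set delta : R | 0 < delta]].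

Definition hausdorff_dim n (E : set 'rV[R]_n) : \bar R :=
  ereal_inf [set s%:E | s in [set s : R |
    0 <= s /\ hausdorff_measure s E = 0%E]].

Definition similarity n (r : R) (f : 'rV[R]_n -> 'rV[R]_n) : Prop :=
  forall x y, edist (f x) (f y) = r * edist x y.

Definition contracting_similarities n m (f : 'I_m -> 'rV[R]_n -> 'rV[R]_n) :
    Prop :=
  forall i, exists2 r : R, 0 < r < 1 & similarity r (f i).

Definition homogeneous_system n m (f : 'I_m -> 'rV[R]_n -> 'rV[R]_n) : Prop :=
  exists2 r : R, 0 < r < 1 & forall i, similarity r (f i).

Definition self_similar_for n m (f : 'I_m -> 'rV[R]_n -> 'rV[R]_n)
    (K : set 'rV[R]_n) : Prop :=
  [/\ contracting_similarities f, K !=set0, compact K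
    & K = \bigcup_(i in [set: 'I_m]) (f i @` K)].

Definition strong_separation n m (f : 'I_m -> 'rV[R]_n -> 'rV[R]_n)
    (K : set 'rV[R]_n) : Prop :=
  forall i j : 'I_m, (i < j)%N -> (f i @` K) `&` (f j @` K) = set0.

Definition self_similar_SSC n (K : set 'rV[R]_n) : Prop :=
  exists m (f : 'I_m -> 'rV[R]_n -> 'rV[R]_n),
    self_similar_for f K /\ strong_separation f K.

Definition homogeneous_self_similar_SSC n (K : set 'rV[R]_n) : Prop :=
  exists m (f : 'I_m -> 'rV[R]_n -> 'rV[R]_n),
    [/\ self_similar_for f K, strong_separation f K & homogeneous_system f].

(* Maps between subsets are encoded as total functions of the ambient spaces
   of which only the values on the subset matter. *)
Definition lipschitz_in n k (A : set 'rV[R]_n) (f : 'rV[R]_n -> 'rV[R]_k) :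
    Prop :=
  exists C : R, forall x z, A x -> A z -> edist (f x) (f z) <= C * edist x z.

Definition lipschitz_onto n k (A : set 'rV[R]_n) (B : set 'rV[R]_k) : Prop :=
  exists f : 'rV[R]_n -> 'rV[R]_k, f @` A = B /\ lipschitz_in A f.

Definition bilipschitz_equivalent n k (A : set 'rV[R]_n) (B : set 'rV[R]_k) :
    Prop :=
  exists (f : 'rV[R]_n -> 'rV[R]_k) (g : 'rV[R]_k -> 'rV[R]_n),
    [/\ set_bij A B f, (forall x, A x -> g (f x) = x),
        lipschitz_in A f & lipschitz_in B g].

End Euclidean.

(* Main.v *)
(* Write s for the common dimension, m for the number of maps of A, whose ratio
   is r, and r_i for the ratios of the maps of B, so that m r^s = 1 and
   sum_i p_i = 1 with p_i = r_i^s. A Lipschitz map f of A onto B pushes the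
   uniform measure of A to a measure mu on B that gives a cylinder [u] the mass
   N(u) m^-l(u), where the integer N(u) is at least 1 by surjectivity and l(u) is
   the level at which the cylinders of A are small enough for f to resolve [u].
   Hence mu is bounded below by a multiple of the natural measure p of B. Near a
   cylinder that almost minimizes mu(u)/p(u), this density is almost constant and
   the integers N are bounded, so that every weight p_w is exactly of the form
   (N'/N) m^-j with N and N' bounded independently of w. Applied to the powers of
   p_i this shows that p_i is rational and that a positive power of it is a power
   of m. So there is an integer q with m = q^t and p_i = q^-b_i. As
   sum_i q^-b_i = 1, Kraft's theorem provides a complete prefix code with word
   lengths b_i, by which both A and B become bilipschitz to the space of q-ary
   streams in which streams with longest common prefix of length l have distance
   q^(-l/s). *)
Require Import Defs.
From mathcomp Require Import all_boot all_order all_algebra.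
From mathcomp Require Import all_classical all_reals all_analysis.
From mathcomp Require Import zify ring lra.
Import Order.TTheory GRing.Theory Num.Theory.
Import numFieldNormedType.Exports.
(* [all_analysis] shadows [edist]. *)
Import Defs.

Set Implicit Arguments.
Unset Strict Implicit.
Unset Printing Implicit Defensive.

Local Open Scope classical_set_scope.
Local Open Scope ring_scope.

(** * Multiplicatively dependent integers and Kraft's theorem *)

(** This is Euclid's algorithm on the exponents. If [x <= y], then [b <= a], so [x ^ b] divides
    [y ^ b] and hence [x] divides [y]. The quotient [w] satisfies [x ^ (a - b) = w ^ b], and
    induction on [x + y] applies to [x] and [w]. *)
Lemma common_root (x y a b : nat) :
  (1 < x)%N -> (1 < y)%N -> (0 < a)%N -> (0 < b)%N -> (x ^ a = y ^ b)%N ->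
  exists z i j : nat, [/\ (0 < i)%N, (0 < j)%N, x = (z ^ i)%N & y = (z ^ j)%N].
Proof.
have [N] := ubnP (x + y); elim: N x y a b => // N IH x y a b ltN x1 y1 a0 b0 exy.
wlog lexy : x y a b ltN x1 y1 a0 b0 exy / (x <= y)%N.
  move=> W; case: (leqP x y) => [|/ltnW] le; first exact: (W x y a b).
  have [|z [i [j [i0 j0 -> ->]]]] := W y x b a _ y1 x1 b0 a0 (esym exy) le.
    by rewrite addnC.
  by exists z, j, i.
have leba : (b <= a)%N.
  rewrite leqNgt; apply/negP => ltab.
  have : (x ^ a < y ^ b)%N.
    by apply: leq_ltn_trans (_ : y ^ a < _)%N; rewrite ?leq_exp2r ?ltn_exp2l.
  by rewrite exy ltnn.
have /dvdnP[w ewx] : (x %| y)%N.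
  by rewrite -(dvdn_pexp2r x y b0) -exy dvdn_exp2l.
have w0 : (0 < w)%N by move: y1; rewrite ewx; case: (w).
have ew : (x ^ (a - b) = w ^ b)%N.
  apply/eqP; rewrite -(eqn_pmul2r (_ : 0 < x ^ b)%N) ?expn_gt0 ?(ltnW x1)//.
  by rewrite -expnD subnK// -expnMn -ewx exy.
have [w1|w1] := leqP w 1.
  have w1' : w = 1%N by apply/eqP; rewrite eqn_leq w1 w0.
  by exists x, 1%N, 1%N; split=> //; rewrite ?expn1// ewx w1' mul1n.
have ab0 : (0 < a - b)%N.
  rewrite lt0n; apply/eqP => e0; have : (1 ^ b = w ^ b)%N by rewrite -ew e0 exp1n.
  by move=> /(expIn b0) w1'; rewrite -w1' in w1.
have ltw : (w < y)%N by rewrite ewx -[ltnLHS]muln1 ltn_pmul2l.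
have [|z [i [j [i0 j0 ex ew']]]] := IH x w (a - b)%N b _ x1 w1 ab0 b0 ew.
  lia.
by exists z, i, (j + i)%N; split; rewrite ?addn_gt0 ?i0 ?orbT// ewx expnD -ew' -ex.
Qed.

Definition mult_dep (x y : nat) :=
  exists a b : nat, [/\ (0 < a)%N, (0 < b)%N & (x ^ a = y ^ b)%N].

(** Take for [q] the least integer above 1 that is multiplicatively dependent on [m]. A common root
    [z] of [q] and [c] is again dependent on [m], so [q <= z], which forces [q = z]. *)
Lemma common_root_family (m : nat) : (1 < m)%N ->
  exists q : nat, (1 < q)%N /\
    forall c, (1 < c)%N -> mult_dep c m -> exists2 b, (0 < b)%N & c = (q ^ b)%N.
Proof.
move=> m1.
suff [q [q1 qm min]] : exists q, [/\ (1 < q)%N, mult_dep q m &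
    forall q', (1 < q')%N -> mult_dep q' m -> (q <= q')%N].
  exists q; split=> // c c1 [a [b [a0 b0 ecm]]].
  case: qm => [a' [b' [a'0 b'0 eqm]]].
  have [|||z [i [j [i0 j0 ec eq]]]] := @common_root c q (a * b') (a' * b) c1 q1.
  - by rewrite muln_gt0 a0.
  - by rewrite muln_gt0 a'0.
  - by rewrite !expnM ecm eqm -!expnM mulnC.
  have z1 : (1 < z)%N.
    by move: q1; rewrite eq; case: z {ec eq} => [|[|z]]//; rewrite ?exp0n ?exp1n.
  have : (q <= z)%N.
    apply: min => //; exists (j * a')%N, b'; split=> //; first by rewrite muln_gt0 j0.
    by rewrite expnM -eq.
  rewrite eq -{2}(expn1 z) leq_exp2l// => j1; have {}j1 : j = 1%N by lia.
  by exists i; [|rewrite ec -[z in LHS]expn1 -j1 -eq].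
pose P q := `[< (1 < q)%N /\ mult_dep q m >].
have exP : exists q, P q by exists m; apply/asboolP; split=> //; exists 1%N, 1%N.
case: (ex_minnP exP) => q /asboolP[q1 qm] min; exists q; split=> // q' *.
by apply: min; apply/asboolP.
Qed.

(** Serves to list code words in the order of their prescribed lengths. *)
Lemma perm_map_lift (T1 T2 : eqType) (f : T1 -> T2) (s : seq T1) (t : seq T2) :
  perm_eq (map f s) t -> exists2 s', perm_eq s' s & map f s' = t.
Proof.
case: s => [|x0 s]; first by rewrite perm_sym => /perm_nilP->; exists [::].
rewrite perm_sym => /(perm_iotaP (f x0))[Is pIs ->]; exists (map (nth x0 (x0 :: s)) Is).
  apply/(perm_iotaP x0); exists Is => //; by rewrite size_map in pIs.
rewrite -map_comp; apply/eq_in_map => i; rewrite (perm_mem pIs) mem_iota size_map.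
by move=> /andP[_ lti]; rewrite /= -(nth_map x0 (f x0)).
Qed.

Section Kraft.
Variable q : nat.

Definition is_prefix (w : seq 'I_q) (s : nat -> 'I_q) := w == mkseq s (size w).

Lemma is_prefix_rcons w d s :
  is_prefix (rcons w d) s = is_prefix w s && (d == s (size w)).
Proof.
by rewrite /is_prefix size_rcons mkseqS eqseq_rcons.
Qed.

Definition prefixes (ws : seq (seq 'I_q)) s := count (is_prefix^~ s) ws.

(** As prefixes are counted with multiplicity, this says at once that the code is prefix-free and
    that it is exhaustive. *)
Definition complete ws := forall s, prefixes ws s = 1%N.

Lemma prefixes_rcons ws s :
  prefixes [seq rcons w d | w <- ws, d <- enum 'I_q] s = prefixes ws s.
Proof.
elim: ws => // w ws IH; rewrite /= /prefixes count_cat [X in (_ + X)%N]IH /=.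
congr (_ + _)%N; rewrite count_map (eq_count (a2 := fun d => is_prefix w s && (d == s (size w)))).
  case: (is_prefix w s) => /=; last by rewrite count_pred0.
  by rewrite count_uniq_mem ?enum_uniq// mem_enum.
by move=> d /=; rewrite is_prefix_rcons.
Qed.

(** Induction on the maximal length. All terms of the sum from shorter words are divisible by [q],
    hence so is the number [n1] of words of length [B.+1]. These are merged into [n1 / q] words of
    length [B], each of which is afterwards replaced by its [q] children. *)
Lemma kraft_seq (B : nat) (bs : seq nat) : (0 < q)%N ->
  all (leq^~ B) bs -> (\sum_(b <- bs) q ^ (B - b) = q ^ B)%N ->
  exists2 ws, complete ws & map size ws = bs.
Proof.
move=> q0; elim: B bs => [|B IH] bs allB sumB.
  have {}sumB : size bs = 1%N.
    rewrite -[RHS](expn0 q) -sumB big_seq (eq_bigr (fun=> 1%N)).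
      by rewrite -big_seq big_const_seq count_predT iter_addn_0 mul1n.
    by move=> b _; rewrite sub0n expn0.
  case: bs sumB allB => [|b []]//= _; rewrite leqn0 andbT => /eqP->.
  by exists [:: [::]].
set lo := [seq b <- bs | (b <= B)%N]; set n1 := count (predC (leq^~ B)) bs.
have hi_eq : [seq b <- bs | ~~ (b <= B)%N] = nseq n1 B.+1.
  rewrite /n1 -size_filter; apply/all_pred1P/allP => b.
  rewrite mem_filter /= -ltnNge => /andP[ltb /(allP allB)/= leb].
  by rewrite eqn_leq ltb leb.
have perm_bs : perm_eq bs (lo ++ nseq n1 B.+1).
  by rewrite -hi_eq perm_sym; apply/permPl/perm_filterC.
have e1 : (\sum_(b <- lo) q ^ (B - b) * q + n1 = q ^ B * q)%N.
  rewrite -expnSr -sumB (perm_big _ perm_bs) big_cat /=.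
  congr (_ + _)%N; last first.
    by rewrite big_nseq subnn expn0 iter_addn_0 mul1n.
  rewrite big_seq [RHS]big_seq; apply: eq_bigr => b; rewrite mem_filter => /andP[le _].
  by rewrite -expnSr -subSn.
have /dvdnP[n' en'] : (q %| n1)%N.
  rewrite -(dvdn_addr _ (dvdn_mull (\sum_(b <- lo) q ^ (B - b))%N (dvdnn q))).
  by rewrite big_distrl/= e1 dvdn_mull.
have [||ws wsc sz_ws] := IH (lo ++ nseq n' B).
- rewrite all_cat all_nseq leqnn orbT andbT; exact: seq.filter_all.
- rewrite big_cat/= big_nseq subnn expn0 iter_addn_0 mul1n.
  by apply/eqP; rewrite -(eqn_pmul2r q0) mulnDl big_distrl/= -en' e1.
pose ws1 := take (size lo) ws; pose ws2 := drop (size lo) ws.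
pose ws' := ws1 ++ [seq rcons w d | w <- ws2, d <- enum 'I_q].
have ws'c : complete ws'.
  move=> s; rewrite /prefixes count_cat -/(prefixes _ s) -/(prefixes _ s) prefixes_rcons.
  by rewrite -[RHS](wsc s) -[in RHS](cat_take_drop (size lo) ws) /prefixes count_cat.
have sz1 : map size ws1 = lo by rewrite map_take sz_ws take_size_cat.
have sz2 : map size ws2 = nseq n' B by rewrite map_drop sz_ws drop_size_cat.
have [s' ps' es'] : exists2 s', perm_eq s' ws' & map size s' = bs.
  apply: perm_map_lift; rewrite perm_sym; apply: (perm_trans perm_bs).
  rewrite map_cat sz1 perm_cat2l en'.
  elim: (ws2) (n') sz2 => [|w v IHv] [|k]//= [ew /IHv{}IHv].
  rewrite mulSn nseqD map_cat -map_comp; apply: perm_cat => //.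
  rewrite (eq_map (g := fun=> B.+1)); last by move=> d /=; rewrite size_rcons ew.
  by rewrite -[in nseq q _](size_enum_ord q); elim: (enum _) => //= _ l; rewrite perm_cons.
by exists s' => // s; rewrite -(ws'c s); apply/permP.
Qed.

Lemma kraft (k B : nat) (b : 'I_k -> nat) : (0 < q)%N ->
  (forall i, b i <= B)%N -> (\sum_i q ^ (B - b i) = q ^ B)%N ->
  exists c : 'I_k -> seq 'I_q, (forall i, size (c i) = b i) /\
    forall s, exists i, forall j, is_prefix (c j) s = (j == i).
Proof.
move=> q0 leB sumB.
have [||ws wsc sz_ws] := @kraft_seq B (map b (enum 'I_k)) q0.
- by apply/allP => _ /mapP[i _ ->] /=.
- by rewrite big_map -sumB big_enum.
have szk : size ws = k by rewrite -(size_map size) sz_ws size_map size_enum_ord.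
exists (fun i => nth [::] ws i); split=> [i|s].
  by rewrite -(nth_map _ 0%N) ?szk// sz_ws (nth_map i) ?size_enum_ord// nth_ord_enum.
have : (\sum_(i < k) is_prefix (nth [::] ws i) s = 1)%N.
  rewrite -(wsc s) /prefixes -sum1_count [RHS]big_mkcond/= (big_nth [::]) szk big_mkord.
  by apply: eq_bigr => i _; case: (is_prefix _ _).
move=> sum1; have [i pi] : exists i : 'I_k, is_prefix (nth [::] ws i) s.
  apply/existsP; apply: contraT; rewrite negb_exists => /forallP no.
  by move: sum1; rewrite big1// => i _; rewrite (negbTE (no i)).
exists i => j; have [->|neji] := eqVneq j i; first by rewrite pi.
apply/negbTE/negP => pj; move: sum1.
by rewrite (bigD1 i)//= (bigD1 j) ?neji//= pi pj.
Qed.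

End Kraft.

(** * Integer-valued densities *)

(** The minimum of [|g|] would otherwise be positive. This turns approximate identities between
    boundedly many candidates into exact ones. *)
Lemma finite_attains_zero (R : realFieldType) (T : finType) (g : T -> R) :
  (forall e : R, 0 < e -> exists t, `|g t| <= e) -> exists t, g t = 0.
Proof.
move=> small; apply: contrapT => no.
have [t0 _] := small 1 ltr01.
have pos t : 0 < `|g t| by rewrite normr_gt0; apply/eqP => gt0; apply: no; exists t.
case: (@arg_minP _ _ _ t0 xpredT (fun t => `|g t|) isT) => t _ min.
have [|t' le] := small (`|g t| / 2); first by rewrite divr_gt0.
have := pos t; have := min t' isT; lra.
Qed.

Section Density.
Variables (R : realType) (k m : nat) (p : 'I_k -> R).
Hypotheses (m2 : (1 < m)%N) (p_gt0 : forall i, 0 < p i).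
Hypothesis p_sum : \sum_i p i = 1.

Definition wprod (u : seq 'I_k) := \prod_(i <- u) p i.

Lemma wprod_gt0 u : 0 < wprod u.
Proof. by apply: prodr_gt0. Qed.

Let wprod_neq0 u : wprod u != 0.
Proof. by rewrite gt_eqF ?wprod_gt0. Qed.

Let m_neq0 : m%:R != 0 :> R.
Proof. by rewrite pnatr_eq0 -lt0n ltnW. Qed.

Lemma wprod_rcons u i : wprod (rcons u i) = wprod u * p i.
Proof. by rewrite /wprod -cats1 big_cat big_seq1. Qed.

Lemma wprod_cat u v : wprod (u ++ v) = wprod u * wprod v.
Proof. exact: big_cat. Qed.

Lemma wprod_sum u : \sum_i wprod (rcons u i) = wprod u.
Proof. by under eq_bigr do rewrite wprod_rcons; rewrite -mulr_sumr p_sum mulr1. Qed.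

Lemma expm_gt0 j : 0 < m%:R ^+ j :> R.
Proof. by rewrite exprn_gt0// ltr0n ltnW. Qed.

(** The quotient [N u / m ^ l u] plays the part of the mass of the cylinder [u], additive by
    [N_sum]. The bounds [M1] and [M2] make [m ^ - l u] comparable with the natural weight
    [wprod u]. *)
Variables (N l : seq 'I_k -> nat) (M1 M2 : R).
Hypothesis N_gt0 : forall u, (0 < N u)%N.
Hypothesis N_sum : forall u,
  \sum_i (N (rcons u i))%:R / m%:R ^+ l (rcons u i) = (N u)%:R / m%:R ^+ l u :> R.
Hypothesis l_mono : forall u i, (l u <= l (rcons u i))%N.
Hypothesis M1_gt0 : 0 < M1.
Hypothesis M1_le : forall u, M1 <= m%:R ^+ l u * wprod u.
Hypothesis M2_ge : forall u, m%:R ^+ l u * wprod u <= M2.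

(** The density of the mass with respect to the natural weight. Its infimum [alpha] need not be
    attained. *)
Let a u := (N u)%:R / m%:R ^+ l u / wprod u.

Let alpha := inf (range a).

Let a_ge u : M2^-1 <= a u.
Proof.
have h := M2_ge u; have X0 := mulr_gt0 (expm_gt0 (l u)) (wprod_gt0 u).
rewrite /a -mulrA -invfM ler_pdivlMr// mulrC ler_pdivrMr ?(lt_le_trans X0)//.
by rewrite (le_trans h)// ler_peMl ?(ltW (lt_le_trans X0 h))// ler1n.
Qed.

Let M2_gt0 : 0 < M2.
Proof. exact: lt_le_trans (mulr_gt0 (expm_gt0 _) (wprod_gt0 [::])) (M2_ge _). Qed.

Let has_inf_a : has_inf (range a).
Proof.
split; first by exists (a [::]), [::].
by exists M2^-1 => _ [u _ <-].
Qed.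

Let alpha_le u : alpha <= a u.
Proof. by apply: ge_inf; [case: has_inf_a | exists u]. Qed.

Let alpha_ge0 : 0 <= alpha.
Proof.
apply: lb_le_inf; first by case: has_inf_a.
by move=> _ [u _ <-]; apply: le_trans (a_ge u); rewrite invr_ge0 ltW.
Qed.

(* The excess of the pushed-forward mass over its least density is additive and
   nonnegative, hence cannot grow along descendants. *)
Let excess u := (N u)%:R / m%:R ^+ l u - alpha * wprod u.

Let excessE u : excess u = (a u - alpha) * wprod u.
Proof. by rewrite mulrBl /a mulfVK// gt_eqF ?wprod_gt0. Qed.

Let excess_ge0 u : 0 <= excess u.
Proof. by rewrite excessE mulr_ge0 ?subr_ge0// ltW ?wprod_gt0. Qed.

Let excess_rcons u i : excess (rcons u i) <= excess u.
Proof.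
have -> : excess u = \sum_j excess (rcons u j).
  by rewrite sumrB N_sum -mulr_sumr wprod_sum.
by rewrite (bigD1 i)//= lerDl sumr_ge0.
Qed.

Let excess_cat u w : excess (u ++ w) <= excess u.
Proof.
elim/last_ind: w => [|w i IH]; first by rewrite cats0.
by rewrite -rcons_cat (le_trans (excess_rcons _ _)).
Qed.

Let l_cat u w : (l u <= l (u ++ w))%N.
Proof.
elim/last_ind: w => [|w i IH]; first by rewrite cats0.
by rewrite -rcons_cat (leq_trans IH).
Qed.

Lemma bounded_ratio : exists K : nat, forall w, exists N1 N2 j : nat,
  [/\ (0 < N1 <= K)%N, (0 < N2 <= K)%N & wprod w * N1%:R * m%:R ^+ j = N2%:R].
Proof.
(* [N u] is [a u] times a factor of at most [M2], so [K] bounds it as soon as [a u <= alpha + 1]. *)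
pose K := Num.bound ((alpha + 1) * M2).
have leK u : a u <= alpha + 1 -> (N u <= K)%N.
  move=> au; rewrite -(ler_nat R); apply: le_trans (ltW (archi_boundP _)); last first.
    by rewrite mulr_ge0// ?addr_ge0// ltW.
  have -> : (N u)%:R = a u * (m%:R ^+ l u * wprod u).
    by rewrite /a; field; rewrite wprod_neq0 expf_neq0 ?m_neq0.
  apply: ler_pM => //.
    exact: le_trans (alpha_le u).
  by rewrite mulr_ge0// ltW ?expm_gt0 ?wprod_gt0.
exists K => w; have pw0 := wprod_gt0 w.
(* Bounds the difference of levels between [u] and [u ++ w], uniformly in [u]. Unlike [K] it may
   depend on [w]: it only has to make the set of candidate triples finite. *)
pose J := Num.bound (M2 / (M1 * wprod w)).
(* The value 1 keeps triples with a zero count from being a zero of [g]. *)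
pose g (t : 'I_K.+1 * 'I_K.+1 * 'I_J.+1) : R :=
  if ((0 < t.1.1) && (0 < t.1.2))%N then
  wprod w * t.1.1%:R * m%:R ^+ t.2 - t.1.2%:R else 1.
have [|[[n1 n2] j]] := @finite_attains_zero R _ g; last first.
  rewrite /g/=; case: ifP => [/andP[n10 n20] /eqP|_ /eqP]; last by rewrite oner_eq0.
  by rewrite subr_eq0 => /eqP; exists n1, n2, j; rewrite n10 n20 !leq_ord.
move=> e e0.
(* If [a u] is within [eta] of [alpha], then [a (u ++ w)] is within [eta / wprod w] of it, as the
   excess does not grow. Both gaps must be at most 1 for the bound [K], and at most [e / M2] for the
   final error. *)
pose eta := Num.min (Num.min 1 (wprod w)) (Num.min e (e * wprod w) / M2).
have eta0 : 0 < eta.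
  by rewrite !lt_min ltr01 pw0/= divr_gt0// lt_min e0 mulr_gt0.
have [_ [u _ <-] au] := inf_adherent eta0 has_inf_a.
rewrite -/alpha in au.
have eta1 : eta <= 1 by rewrite !ge_min lexx.
have eta2 : eta / wprod w <= 1 by rewrite ler_pdivrMr// mul1r !ge_min lexx orbT.
have eta3 : eta * M2 <= e.
  rewrite -ler_pdivlMr// ge_min; apply/orP; right.
  by rewrite ler_pM2r ?invr_gt0// ge_min lexx.
have eta4 : eta / wprod w * M2 <= e.
  rewrite mulrAC ler_pdivrMr// -ler_pdivlMr// ge_min; apply/orP; right.
  by rewrite ler_pM2r ?invr_gt0// ge_min lexx orbT.
have auw : a (u ++ w) - alpha <= eta / wprod w.
  have := excess_cat u w; rewrite !excessE wprod_cat mulrC -mulrA.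
  rewrite [leRHS]mulrC ler_pM2l ?wprod_gt0// mulrC -ler_pdivlMr// => /le_trans; apply.
  by rewrite ler_pM2r ?invr_gt0// lerBlDl ltW.
have Nu : (N u <= K)%N by apply: leK; lra.
have Nuw : (N (u ++ w) <= K)%N by apply: leK; lra.
have [j ej] : exists j, l (u ++ w) = (j + l u)%N.
  by exists (l (u ++ w) - l u)%N; rewrite subnK.
have Y0 := mulr_gt0 (expm_gt0 (l (u ++ w))) (wprod_gt0 (u ++ w)).
have YM := M2_ge (u ++ w).
have Ye : m%:R ^+ l (u ++ w) * wprod (u ++ w) = m%:R ^+ j * wprod w * (m%:R ^+ l u * wprod u).
  by rewrite ej wprod_cat exprD; ring.
have ltj : (j < J.+1)%N.
  rewrite ltnS ltnW// -(ltr_nat R); apply: (@lt_trans _ _ (m%:R ^+ j)).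
    by rewrite -natrX ltr_nat ltn_expl.
  apply: le_lt_trans (archi_boundP _); last first.
    by rewrite divr_ge0 ?mulr_ge0// ltW.
  rewrite ler_pdivlMr ?mulr_gt0//; apply: le_trans YM; rewrite Ye.
  by rewrite -!mulrA ler_pM2l ?expm_gt0// mulrC ler_pM2l.
exists (inord (N u), inord (N (u ++ w)), Ordinal ltj).
rewrite /g/= !inordK// !N_gt0/=.
have -> : wprod w * (N u)%:R * m%:R ^+ j - (N (u ++ w))%:R =
   (a u - a (u ++ w)) * (m%:R ^+ l (u ++ w) * wprod (u ++ w)).
  rewrite mulrBl {1}Ye /a; field.
  by rewrite !wprod_neq0 !expf_neq0 ?m_neq0.
rewrite normrM [X in _ * X]gtr0_norm//.
have := alpha_le u; have := alpha_le (u ++ w) => h1 h2.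
have : `|a u - a (u ++ w)| <= Num.max eta (eta / wprod w).
  rewrite ler_norml le_max; apply/andP; split; last by apply/orP; left; lra.
  by rewrite lerNl le_max; apply/orP; right; lra.
move=> hmax; apply: (@le_trans _ _ (Num.max eta (eta / wprod w) * M2)).
  by apply: ler_pM => //; exact: ltW.
by case: (leP eta (eta / wprod w)).
Qed.

End Density.

(** By the pigeonhole principle two exponents [n < n'] share [N1] and [N2]. Dividing their
    identities gives [x ^ e = m ^ - b] with [e] and [b] positive. The identity for exponent 1 gives
    [x = B / (A m ^ i)]. Its [e]-th power shows that [B ^ e] divides [(A m ^ i) ^ e], so [1 / x] is
    an integer. *)
Lemma inverse_mult_dep (R : realType) (m : nat) (x : R) (K : nat) : (1 < m)%N -> 0 < x < 1 ->
  (forall n, exists N1 N2 j : nat,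
  [/\ (0 < N1 <= K)%N, (0 < N2 <= K)%N & x ^+ n * N1%:R * m%:R ^+ j = N2%:R]) ->
  exists c : nat, [/\ (1 < c)%N, mult_dep c m & x = c%:R^-1].
Proof.
move=> m2 /andP[x0 x1] /choice[N1 /choice[N2 /choice[j H]]].
have m0 : m%:R != 0 :> R by rewrite pnatr_eq0; lia.
have [n [n' [ltn eN1 eN2]]] : exists n n', [/\ (n < n')%N, N1 n = N1 n' & N2 n = N2 n'].
  pose F (n : 'I_(K.+1 * K.+1).+1) : 'I_K.+1 * 'I_K.+1 := (inord (N1 n), inord (N2 n)).
  have : ~~ injectiveb F.
    apply/injectiveP => /leq_card; rewrite card_prod !card_ord; lia.
  move=> /injectivePn[n [n' nen']] [/(congr1 val)/= e1 /(congr1 val)/= e2].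
  move: e1 e2; case: (H n) (H n') => [/andP[_ h1] /andP[_ h2] _] [/andP[_ h3] /andP[_ h4] _].
  rewrite !inordK// => e1 e2.
  case: (ltngtP n n') => [lt|lt|/val_inj e]; last by rewrite e eqxx in nen'.
    by exists n, n'.
  by exists n', n.
have [h1 _ en] := H n; have [_ _ en'] := H n'.
have N1n0 : (N1 n)%:R != 0 :> R by rewrite pnatr_eq0; lia.
have exp_eq : x ^+ (n' - n) * m%:R ^+ j n' = m%:R ^+ j n.
  apply: (mulfI N1n0); apply: (@mulfI _ (x ^+ n)); first by rewrite expf_neq0 ?gt_eqF.
  have -> : x ^+ n * ((N1 n)%:R * m%:R ^+ j n) = x ^+ n' * (N1 n')%:R * m%:R ^+ j n'.
    by rewrite mulrA en eN2 en'.
  have -> : x ^+ n' = x ^+ (n' - n) * x ^+ n by rewrite -exprD subnK// ltnW.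
  by rewrite eN1; ring.
have ltj : (j n < j n')%N.
  rewrite -(ltr_eXn2l (_ : 1 < m%:R :> R)) ?ltr1n// -exp_eq gtr_pMl.
    by rewrite exprn_ilt1 ?subn_eq0 -?ltnNge// ltW.
  by rewrite exprn_gt0// ltr0n ltnW.
pose b := (j n' - j n)%N; pose e := (n' - n)%N.
have b0 : (0 < b)%N by rewrite subn_gt0. have e0 : (0 < e)%N by rewrite subn_gt0.
have xe : x ^+ e * m%:R ^+ b = 1.
  apply: (@mulIf _ (m%:R ^+ j n)); first by rewrite expf_neq0.
  by rewrite -mulrA -exprD subnK ?(ltnW ltj)// mul1r.
have [/andP[a1 _] /andP[a2 _]] := H 1%N; rewrite expr1.
set A := N1 1%N; set B := N2 1%N; set i := j 1%N => e1.
have natE : ((A * m ^ i) ^ e = B ^ e * m ^ b)%N.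
  apply/eqP; rewrite -(eqr_nat R) !(natrM, natrX) -e1; apply/eqP.
  transitivity ((A%:R * m%:R ^+ i) ^+ e * (x ^+ e * m%:R ^+ b)).
    by rewrite xe mulr1.
  by rewrite !exprMn; ring.
have /dvdnP[c ec] : (B %| A * m ^ i)%N.
  by rewrite -(dvdn_pexp2r _ _ e0) natE dvdn_mulr.
have ce : (c ^ e = m ^ b)%N.
  apply/eqP; rewrite -(eqn_pmul2l (_ : 0 < B ^ e)%N) ?expn_gt0 ?a2//.
  by rewrite -natE ec expnMn mulnC.
have xE : x = c%:R^-1.
  have B0 : B%:R != 0 :> R by rewrite pnatr_eq0 -lt0n.
  have c0 : c%:R != 0 :> R.
    rewrite pnatr_eq0; apply/eqP => c0; move: ce; rewrite c0 exp0n// => /eqP.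
    by rewrite eq_sym expn_eq0; lia.
  apply: (mulIf c0); rewrite mulVf//; apply: (mulIf B0).
  by rewrite mul1r -mulrA -natrM -ec natrM natrX mulrA.
exists c; split => //; last by exists e, b.
have : x^-1 > 1 by rewrite invf_gt1.
by rewrite xE invrK ltr1n.
Qed.

(** * Symbolic codings *)

Definition agree (T : Type) (l : nat) (s t : nat -> T) :=
  forall j, (j < l)%N -> s j = t j.

Lemma agree_leq (T : Type) l l' (s t : nat -> T) :
  (l' <= l)%N -> agree l s t -> agree l' s t.
Proof. by move=> le h j lt; apply: h; exact: leq_trans le. Qed.

Lemma first_difference (T : Type) (s t : nat -> T) l :
  ~ agree l s t -> exists n, [/\ (n < l)%N, agree n s t & s n <> t n].
Proof.
elim: l => [|l IH] nag; first by case: nag.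
have [ag|/IH[n [lt ag ne]]] := pselect (agree l s t); last by exists n; split=> //; lia.
exists l; split=> // e; apply: nag => j; rewrite ltnS leq_eqVlt => /orP[/eqP->//|].
exact: ag.
Qed.

Lemma agree_mkseq (T : Type) l (s t : nat -> T) :
  agree l s t <-> mkseq s l = mkseq t l.
Proof.
split=> [ag|e j lt]; last by rewrite -(nth_mkseq (s j) s lt) e nth_mkseq.
apply: (@eq_from_nth _ (s 0%N)); rewrite !size_mkseq// => i lti.
by rewrite !nth_mkseq ?ag.
Qed.

Section Coding.
Variable R : realType.

Definition scale (m : nat) (r : 'I_m -> R) (s : nat -> 'I_m) l : R :=
  \prod_(j < l) r (s j).

Lemma scaleS m (r : 'I_m -> R) s l : scale r s l.+1 = scale r s l * r (s l).
Proof. exact: big_ord_recr. Qed.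

Lemma scale_gt0 m (r : 'I_m -> R) s l : (forall i, 0 < r i) -> 0 < scale r s l.
Proof. by move=> r0; apply: prodr_gt0. Qed.

(* [ad] assigns to the points of [K] the streams of indices of the pieces that
   contain them, and the distance is comparable with the ratio of the longest
   common prefix. *)
Definition coding n m (K : set 'rV[R]_n) (r : 'I_m -> R)
    (ad : 'rV[R]_n -> nat -> 'I_m) :=
  [/\ exists2 D : R, 0 < D & forall x y l, K x -> K y -> agree l (ad x) (ad y) ->
        edist x y <= D * scale r (ad x) l,
      exists2 c : R, 0 < c & forall x y l, K x -> K y -> agree l (ad x) (ad y) ->
        ad x l <> ad y l -> c * scale r (ad x) l <= edist x y
    & forall s, exists2 x, K x & forall j, ad x j = s j].

Lemma edist_ge0 n (x y : 'rV[R]_n) : 0 <= edist x y.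
Proof. exact: sqrtr_ge0. Qed.

Lemma edist_xx n (x : 'rV[R]_n) : edist x x = 0.
Proof. by rewrite /edist big1 ?sqrtr0// => i _; rewrite subrr expr0n. Qed.

Lemma edist_eq0 n (x y : 'rV[R]_n) : edist x y = 0 -> x = y.
Proof.
move=> /eqP; rewrite sqrtr_eq0 => le0; apply/rowP => i.
have := le0; rewrite le_eqVlt [X in _ || X]ltNge sumr_ge0 ?orbF; last first.
  by move=> j _; rewrite sqr_ge0.
rewrite psumr_eq0; last by move=> j _; rewrite sqr_ge0.
by move=> /allP/(_ i (mem_index_enum _)); rewrite sqrf_eq0 subr_eq0 => /eqP; rewrite !ord1.
Qed.

Lemma coding_point n m (K : set 'rV[R]_n) (r : 'I_m -> R) ad : coding K r ad ->
  exists2 pt, forall s, K (pt s) & forall s j, ad (pt s) j = s j.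
Proof.
move=> [_ _ surj].
have /choice[pt Hpt] : forall s, exists x, K x /\ forall j, ad x j = s j.
  by move=> s; have [x] := surj s; exists x.
by exists pt => s; have [] := Hpt s.
Qed.

(** * Sets coded by the same streams with the same ratio *)

Section Bilip.
Variables (q : nat) (rho : R).
Hypothesis rho01 : 0 < rho < 1.

Let sc n (ad : 'rV[R]_n -> nat -> 'I_q) x l : scale (fun=> rho) (ad x) l = rho ^+ l.
Proof. by rewrite /scale prodr_const card_ord. Qed.

Lemma coding_inj n (K : set 'rV[R]_n) (ad : 'rV[R]_n -> nat -> 'I_q) x y :
  coding K (fun=> rho) ad -> K x -> K y -> (forall j, ad x j = ad y j) -> x = y.
Proof.
move=> [[D D0 hD] _ _] Kx Ky ag; apply: edist_eq0; apply: contrapT => /eqP d0.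
have {}d0 : 0 < edist x y by rewrite lt_neqAle eq_sym d0 edist_ge0.
have /andP[rho0 rho1] := rho01.
have /cvgrPdist_lt/(_ _ (divr_gt0 d0 D0))[l _ /(_ l (leqnn l))] :
    GRing.exp rho @ \oo --> (0 : R) by apply: cvg_expr; rewrite gtr0_norm.
rewrite /= sub0r normrN normrX gtr0_norm// ltr_pdivlMr// ltNge => /negP; apply.
by rewrite mulrC -(sc ad x); apply: hD.
Qed.

(** As [f] preserves addresses, the first difference [n'] of two addresses controls both distances:
    it bounds the one in [A] below by [c rho ^ n'] and the one in [B] above by [D rho ^ n']. *)
Lemma coding_lipschitz n k (A : set 'rV[R]_n) (B : set 'rV[R]_k)
    (ad : 'rV[R]_n -> nat -> 'I_q) (bd : 'rV[R]_k -> nat -> 'I_q) f :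
  coding A (fun=> rho) ad -> coding B (fun=> rho) bd ->
  (forall x, A x -> B (f x)) -> (forall x, A x -> forall j, bd (f x) j = ad x j) ->
  lipschitz_in A f.
Proof.
move=> cA [[D D0 hD] _ _] fB fad; have [_ [c c0 hc] _] := cA.
exists (D / c) => x z Ax Az.
have [ag|/existsNP[l nl]] := pselect (forall j, ad x j = ad z j).
  by rewrite (coding_inj cA Ax Az ag) !edist_xx mulr0.
have [|n' [_ ag ne]] := @first_difference _ (ad x) (ad z) l.+1.
  by move=> /(_ l (leqnn _)).
apply: (@le_trans _ _ (D * rho ^+ n')).
  rewrite -(sc bd (f x)); apply: hD; [exact: fB|exact: fB|].
  by move=> j lt; rewrite !fad// ag.
by rewrite -mulrA ler_pM2l// ler_pdivlMl// -(sc ad x) hc.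
Qed.

Lemma coding_bilipschitz n k (A : set 'rV[R]_n) (B : set 'rV[R]_k)
    (ad : 'rV[R]_n -> nat -> 'I_q) (bd : 'rV[R]_k -> nat -> 'I_q) :
  coding A (fun=> rho) ad -> coding B (fun=> rho) bd ->
  bilipschitz_equivalent A B.
Proof.
move=> cA cB; have [pa Apa pad] := coding_point cA; have [pb Bpb pbd] := coding_point cB.
exists (pb \o ad), (pa \o bd); split.
- split=> [x _|x z Ax Az e|y By]; first exact: Bpb; last first.
    exists (pa (bd y)); first exact: Apa.
    by apply: (coding_inj cB) => // [|j]; [exact: Bpb | rewrite pbd pad].
  move: Ax Az; rewrite !inE => Ax Az; apply: (coding_inj cA) => // j.
  by rewrite -pbd [pb _]e pbd.
- by move=> x Ax; apply: (coding_inj cA) => // [|j]; [exact: Apa|rewrite /= pad pbd].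
- by apply: (coding_lipschitz cA cB) => x Ax *; [exact: Bpb|exact: pbd].
- by apply: (coding_lipschitz cB cA) => x Ax *; [exact: Apa|exact: pad].
Qed.

End Bilip.

(** * Recoding streams by a complete prefix code *)

Section Recode.
Variables (q m : nat) (d0 : 'I_q) (c : 'I_m -> seq 'I_q).
Hypothesis c_gt0 : forall i, (0 < size (c i))%N.
Hypothesis c_complete : forall s, exists i, forall j, is_prefix (c j) s = (j == i).

Definition spell (s : nat -> 'I_m) n := flatten (mkseq (c \o s) n).

(** The infinite concatenation of the code words along [s]. The first [j.+1] of them have more than
    [j] digits, as no code word is empty, so the default [d0] does not show. *)
Definition concat (s : nat -> 'I_m) j := nth d0 (spell s j.+1) j.

Lemma spellS s n : spell s n.+1 = spell s n ++ c (s n).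
Proof. by rewrite /spell mkseqS -cats1 flatten_cat /= cats0. Qed.

Lemma spell_prefix s n n' : (n <= n')%N -> exists w, spell s n' = spell s n ++ w.
Proof.
move=> /subnK <-; elim: (n' - n)%N => [|k [w IH]]; first by exists [::]; rewrite cats0.
by exists (w ++ c (s (k + n)%N)); rewrite addSn spellS IH catA.
Qed.

Lemma size_spell_ge s n : (n <= size (spell s n))%N.
Proof. by elim: n => // n IH; rewrite spellS size_cat; have := c_gt0 (s n); lia. Qed.

Lemma spell_agree s t n : agree n s t -> spell s n = spell t n.
Proof. by move=> ag; rewrite /spell; congr flatten; apply/agree_mkseq => j /ag /= ->. Qed.

Lemma concat_nth s n j : (j < size (spell s n))%N -> concat s j = nth d0 (spell s n) j.
Proof.
move=> lt; rewrite /concat; have lt' := size_spell_ge s j.+1.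
by case: (leqP n j.+1) => [|/ltnW] /(spell_prefix s)[w ->]; rewrite nth_cat ?lt ?lt'.
Qed.

Lemma concat_prefix s n : is_prefix (c (s n)) (fun j => concat s (size (spell s n) + j)).
Proof.
apply/eqP; apply: (@eq_from_nth _ d0) => [|j lt]; first by rewrite size_mkseq.
rewrite nth_mkseq// (@concat_nth s n.+1) spellS; last by rewrite size_cat ltn_add2l.
by rewrite nth_cat ltnNge leq_addr addKn.
Qed.

Lemma concat_agree s t n : agree n s t -> agree (size (spell s n)) (concat s) (concat t).
Proof.
by move=> ag j lt; rewrite !(@concat_nth _ n)// -?(spell_agree ag).
Qed.

(** After the common part, agreement on [B] more digits would make both [c (s n)] and [c (t n)]
    prefixes of one stream, against the uniqueness in [c_complete]. *)
Lemma concat_differ s t n B : (forall i, (size (c i) <= B)%N) ->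
  agree n s t -> s n <> t n -> ~ agree (size (spell s n) + B) (concat s) (concat t).
Proof.
move=> leB ag ne ag'; apply: ne.
have [i Hi] := c_complete (fun j => concat s (size (spell s n) + j)).
have /eqP -> : s n == i by rewrite -Hi concat_prefix.
apply/esym/eqP; rewrite -Hi; have := concat_prefix t n.
rewrite /is_prefix -(spell_agree ag) => /eqP {1}->; apply/eqP/agree_mkseq => j lt.
by rewrite ag'// ltn_add2l (leq_trans lt).
Qed.

(** Greedy decoding: [hd] finds the code word with which a stream starts and [next] strips it. *)
Lemma concat_surj t : exists s, forall j, concat s j = t j.
Proof.
have /choice[hd hdP] : forall s, exists i, is_prefix (c i) s.
  by move=> s; have [i Hi] := c_complete s; exists i; rewrite Hi.
pose next s := fun j => s (size (c (hd s)) + j)%N : 'I_q.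
pose s n := hd (iter n next t).
have iterE n j : iter n next t j = t (size (spell s n) + j)%N.
  elim: n j => // n IH j; rewrite spellS size_cat -addnA -IH.
  by rewrite iterS.
have spellE n : spell s n = mkseq t (size (spell s n)).
  elim: n => // n IH; rewrite spellS size_cat {1}IH.
  have /eqP -> := hdP (iter n next t).
  rewrite size_mkseq /mkseq iotaD map_cat; congr (_ ++ _).
  rewrite add0n -[in RHS](addn0 (size (spell s n))) iotaDl -map_comp.
  by apply: eq_map => j /=; rewrite iterE.
exists s => j; have lt := size_spell_ge s j.+1.
by rewrite /concat spellE nth_mkseq.
Qed.

Lemma coding_concat n (K : set 'rV[R]_n) (ad : 'rV[R]_n -> nat -> 'I_m) (rho : R) :
  0 < rho < 1 -> coding K (fun i => rho ^+ size (c i)) ad ->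
  coding K (fun=> rho) (concat \o ad).
Proof.
move=> /andP[rho0 rho1] [[D D0 hD] [g g0 hg] surj].
pose B := \max_i size (c i); have leB i : (size (c i) <= B)%N by exact: leq_bigmax.
have scE s l : scale (fun i => rho ^+ size (c i)) s l = rho ^+ size (spell s l).
  elim: l => [|l IH]; first by rewrite /scale big_ord0.
  by rewrite scaleS IH spellS size_cat exprD.
have scE' (s : nat -> 'I_q) l : scale (fun=> rho) s l = rho ^+ l.
  by rewrite /scale prodr_const card_ord.
split.
(* Recoded streams may agree on up to [B] digits beyond the code words they share, which costs the
   factor [rho ^ - B]. *)
- exists (D / rho ^+ B); first by rewrite divr_gt0// exprn_gt0.
  move=> x y l Kx Ky ag; rewrite scE'.
  have [n' [le ag' ne]] : exists n', [/\ (l <= size (spell (ad x) n') + B)%N,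
      agree n' (ad x) (ad y) & True].
    have [ag1|/first_difference[n' [lt ag1 ne]]] := pselect (agree l (ad x) (ad y)).
      by exists l; split=> //; have := size_spell_ge (ad x) l; lia.
    exists n'; split=> //; apply/ltnW; rewrite ltnNge; apply/negP => le.
    exact: (concat_differ leB ag1 ne (agree_leq le ag)).
  apply: le_trans (hD _ _ _ Kx Ky ag') _; rewrite scE -mulrA ler_pM2l//.
  rewrite ler_pdivlMl ?exprn_gt0// -exprD addnC.
  by apply: ler_wiXn2l le; exact: ltW.
- exists g => // x y l Kx Ky ag ne; rewrite scE'.
  have /first_difference[n' [lt ag' ne']] : ~ agree l.+1 (ad x) (ad y).
    move=> /concat_agree ag'; apply: ne; apply: ag'.
    exact: leq_trans (size_spell_ge _ _).
  apply: le_trans (hg _ _ _ Kx Ky ag' ne'); rewrite ler_pM2l// scE.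
  apply: ler_wiXn2l; rewrite ?ltW//.
  rewrite leqNgt; apply/negP => lt'; apply: ne.
  exact: (concat_agree ag').
- move=> s; have [t Ht] := concat_surj s; have [x Kx Hx] := surj t.
  by exists x => // j; rewrite -Ht /=; congr concat; apply/funext.
Qed.

End Recode.
End Coding.

(** * Codings of self-similar sets with strong separation *)

Section SelfSimilar.
Variable R : realType.

Lemma coord_le_edist n (x y : 'rV[R]_n) i : `|x ord0 i - y ord0 i| <= edist x y.
Proof.
rewrite -sqrtr_sqr; apply: ler_wsqrtr.
by rewrite (bigD1 i)//= lerDl sumr_ge0// => j _; rewrite sqr_ge0.
Qed.

Lemma edist_continuous n : continuous (fun z : 'rV[R]_n * 'rV[R]_n => edist z.1 z.2).
Proof.
move=> z; apply: (@continuous_comp _ _ _ (fun z : 'rV[R]_n * 'rV[R]_n =>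
  \sum_(i < n) (z.1 ord0 i - z.2 ord0 i) ^+ 2) Num.sqrt); last exact: sqrt_continuous.
apply: cvg_big => [|i _]; first exact: add_continuous.
have h : (fun z : 'rV[R]_n * 'rV[R]_n => z.1 ord0 i - z.2 ord0 i) @ z -->
    z.1 ord0 i - z.2 ord0 i.
  apply: cvgB.
    by apply: (@continuous_comp _ _ _ fst (fun x : 'rV[R]_n => x ord0 i));
      [exact: cvg_fst | exact: coord_continuous].
  by apply: (@continuous_comp _ _ _ snd (fun x : 'rV[R]_n => x ord0 i));
      [exact: cvg_snd | exact: coord_continuous].
exact: (cvgM h h).
Qed.

Lemma similarity_continuous n r (f : 'rV[R]_n -> 'rV[R]_n) :
  similarity r f -> continuous f.
Proof.
move=> simf x; have FF : Filter (nbhs x) by exact: nbhs_filter. apply/cvg_ballP => e e0.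
have : (fun y => r * edist x y) @ x --> r * edist x x.
  apply: cvgM; first exact: cvg_cst.
  apply: (@continuous_comp _ _ _ (fun y => (x, y)) (fun z => edist z.1 z.2)); last first.
    exact: edist_continuous.
  apply: (@cvg_pair _ _ _ _ (nbhs x) (nbhs x) FF FF); [exact: cvg_cst | exact: cvg_id].
rewrite edist_xx mulr0 => /cvgrPdist_lt/(_ e e0) H.
apply: (filterS _ H) => y /=.
rewrite sub0r normrN -simf ger0_norm ?edist_ge0// => lt; split=> // i j.
rewrite ord1 /ball /=; apply: le_lt_trans lt; exact: (coord_le_edist (f x) (f y) j).
Qed.


Lemma edist_bounded n (K : set 'rV[R]_n) : compact K ->
  exists2 D : R, 0 < D & forall x y, K x -> K y -> edist x y <= D.
Proof.
move=> cK; have [[x0 Kx0]|K0] := pselect (K !=set0); last first.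
  by exists 1 => // x y Kx; case: K0; exists x.
have [|||z _ hz] := @compact_EVT_max _ R (fun z : 'rV[R]_n * 'rV[R]_n => edist z.1 z.2) (K `*` K).
- by exists (x0, x0).
- exact: compact_setX.
- exact/continuous_subspaceT/edist_continuous.
exists (edist z.1 z.2 + 1); first by rewrite ltr_wpDl ?edist_ge0.
by move=> x y Kx Ky; rewrite ler_wpDr// (hz (x, y))// inE.
Qed.

Lemma edist_separated n (K L : set 'rV[R]_n) : compact K -> compact L -> K `&` L = set0 ->
  exists2 c : R, 0 < c & forall x y, K x -> L y -> c <= edist x y.
Proof.
move=> cK cL KL0.
have [[x0 Kx0]|K0] := pselect (K !=set0); last first.
  by exists 1 => // x y Kx; case: K0; exists x.
have [[y0 Ly0]|L0] := pselect (L !=set0); last first.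
  by exists 1 => // x y _ Ly; case: L0; exists y.
have [|||z zKL hz] := @compact_EVT_min _ R (fun z : 'rV[R]_n * 'rV[R]_n => edist z.1 z.2) (K `*` L).
- by exists (x0, y0).
- exact: compact_setX.
- exact/continuous_subspaceT/edist_continuous.
exists (edist z.1 z.2); last by move=> x y Kx Ly; rewrite (hz (x, y))// inE.
rewrite lt_neqAle edist_ge0 andbT; apply/eqP => /esym/edist_eq0 e.
move: zKL; rewrite inE => -[Kz Lz]; rewrite -e in Lz.
by have : (K `&` L) z.1 by []; rewrite KL0.
Qed.

Lemma nested_compact n (C : nat -> set 'rV[R]_n) :
  (forall j, compact (C j)) -> (forall j, C j !=set0) -> (forall j, C j.+1 `<=` C j) ->
  exists x, forall j, C j x.
Proof.
move=> cC /choice[u Cu] sub.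
have subD i j : (i <= j)%N -> C j `<=` C i.
  move=> /subnK <-; elim: (j - i)%N => // d IH x Cx; apply: IH; exact: sub.
have [|x [_ clx]] := cC 0%N (u @ \oo) _.
  by exists 0%N => // k _ /=; apply: subD (Cu k).
exists x => j; have : closed (C j) by apply: compact_closed => //; exact: norm_hausdorff.
apply => V nV; apply: clx => //.
by exists j => // k /= le; apply: subD (Cu k).
Qed.

Lemma uniform_bound (T : finType) (P : T -> R -> Prop) :
  (forall t c c', c' <= c -> P t c -> P t c') ->
  (forall t, exists2 c : R, 0 < c & P t c) -> exists2 c : R, 0 < c & forall t, P t c.
Proof.
move=> mono ex; have /choice[g gP] : forall t, exists c : R, 0 < c /\ P t c.
  by move=> t; have [c] := ex t; exists c.
exists (\big[Num.min/1]_t g t); first by apply: lt_bigmin => // t _; have [] := gP t.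
by move=> t; apply: mono (gP t).2; exact: bigmin_le_cond.
Qed.

(** The image of [K] under the composition of the first [l] maps along [s], with [f (s 0)]
    outermost. *)
Fixpoint piece n m (f : 'I_m -> 'rV[R]_n -> 'rV[R]_n) (K : set 'rV[R]_n) l
    (s : nat -> 'I_m) : set 'rV[R]_n :=
  if l is l'.+1 then f (s 0%N) @` piece f K l' (fun j => s j.+1) else K.

(** While addresses agree, distances are exact multiples of distances between preimages in [K]. The
    upper bound then comes from the boundedness of [K], the lower one from the positive distance
    between distinct first-level pieces, and surjectivity from compactness. *)
Lemma coding_exists n m (f : 'I_m -> 'rV[R]_n -> 'rV[R]_n) (r : 'I_m -> R)
    (K : set 'rV[R]_n) :
  (forall i, 0 < r i) -> (forall i, similarity (r i) (f i)) ->
  K !=set0 -> compact K -> K = \bigcup_(i in [set: 'I_m]) (f i @` K) ->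
  strong_separation f K -> exists ad, coding K r ad.
Proof.
move=> r0 simf [x0 Kx0] cK KE ssc.
have fK i x : K x -> K (f i x) by move=> Kx; rewrite KE; exists i => //; exists x.
have fcont i : continuous (f i) by exact: similarity_continuous (simf i).
have finj i x y : f i x = f i y -> x = y.
  move=> e; apply: edist_eq0; apply: (mulfI (_ : r i != 0)); first by rewrite gt_eqF.
  by rewrite -simf e edist_xx mulr0.
have disj i j : i <> j -> (f i @` K) `&` (f j @` K) = set0.
  move=> ne; have [lt|lt|/val_inj//] := ltngtP i j; first exact: ssc.
  by rewrite setIC; exact: ssc.
have sep i j x y : K x -> K y -> f i x = f j y -> i = j.
  move=> Kx Ky e; apply: contrapT => /disj d.
  have : ((f i @` K) `&` (f j @` K)) (f i x) by split; [exists x | rewrite e; exists y].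
  by rewrite d.
have [c c0 hc] : exists2 c : R, 0 < c & forall t : 'I_m * 'I_m, t.1 <> t.2 ->
    forall x y, K x -> K y -> c <= edist (f t.1 x) (f t.2 y).
  apply: uniform_bound => [t c c' le h ne x y Kx Ky|[i j]].
    exact: le_trans le (h ne x y Kx Ky).
  have cont i' : compact (f i' @` K).
    by apply: continuous_compact => //; exact: continuous_subspaceT.
  have [ij|ij] := pselect (i = j); first by exists 1.
  have [c c0 h] := edist_separated (cont i) (cont j) (disj _ _ ij).
  by exists c => // _ x y Kx Ky; apply: h; [exists x | exists y].
have [D D0 hD] := edist_bounded cK.
have [i0 _] : exists i : 'I_m, True by move: Kx0; rewrite KE => -[i]; exists i.
have /choice[h hP] : forall x, exists t : 'I_m * 'rV[R]_n, K x -> K t.2 /\ f t.1 t.2 = x.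
  move=> x; have [Kx|nKx] := pselect (K x); last by exists (i0, x).
  by move: Kx; rewrite {1}KE => -[i _ [y Ky e]]; exists (i, y).
(* [T] undoes the map whose piece contains [x], and [ad x] is the itinerary of [x] under [T]. *)
pose T x := (h x).2; pose ad x l := (h (iter l T x)).1.
have KT x l : K x -> K (iter l T x).
  by move=> Kx; elim: l => //= l IH; case: (hP _ IH).
have fT x l : K x -> f (ad x l) (iter l.+1 T x) = iter l T x.
  by move=> Kx; case: (hP _ (KT x l Kx)).
have distE x y l : K x -> K y -> agree l (ad x) (ad y) ->
    edist x y = scale r (ad x) l * edist (iter l T x) (iter l T y).
  move=> Kx Ky; elim: l => [|l IH] ag; first by rewrite /scale big_ord0 mul1r.
  rewrite IH; last exact: agree_leq ag.
  by rewrite -(fT x l)// -(fT y l)// -[ad y l]ag// simf scaleS mulrA.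
exists ad; split.
- exists D => // x y l Kx Ky ag; rewrite (distE x y l)// mulrC.
  by rewrite ler_pM2r ?scale_gt0//; apply: hD; exact: KT.
- exists c => // x y l Kx Ky ag ne; rewrite (distE x y l)// mulrC.
  rewrite ler_pM2l ?scale_gt0// -(fT x l)// -(fT y l)//.
  by apply: (hc (ad x l, ad y l)) => //; exact: KT.
move=> s.
have [x Cx] : exists x, forall l, piece f K l s x.
  apply: nested_compact => [l|l|l].
  - elim: l s => [|l IH] s //=; apply: continuous_compact (IH _).
    exact: continuous_subspaceT.
  - elim: l s => [|l IH] s /=; first by exists x0.
    by have [y Cy] := IH (fun j => s j.+1); exists (f (s 0%N) y); exists y.
  - elim: l s => [|l IH] s x; first by move=> [y Ky <-]; exact: fK.
    by move=> [y Cy <-]; exists y => //; exact: IH.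
exists x; first exact: (Cx 0%N).
move=> l; elim: l s x Cx => [|l IH] s x Cx.
  have [y Ky e] := Cx 1%N.
  apply: (sep _ _ _ y (KT x 1%N (Cx 0%N)) Ky).
  by rewrite e (fT x 0%N (Cx 0%N)).
(* The first digit is settled by disjointness of the pieces. Then [T x] lies in all pieces of the
   shifted stream, to which the induction hypothesis applies. *)
have e0 : f (s 0%N) (T x) = x.
  have [y Ky e] := Cx 1%N.
  by have [KTx eT] := hP _ (Cx 0%N); rewrite -{2}eT -(sep _ _ _ _ KTx Ky (etrans eT (esym e))).
rewrite /ad iterSr; apply: (IH (fun j => s j.+1)) => k.
by have [y Cy e] := Cx k.+1; rewrite -(finj (s 0%N) y (T x))// e e0.
Qed.

End SelfSimilar.

(** * Hausdorff dimension *)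

Fixpoint words m l : seq (seq 'I_m) :=
  if l is l'.+1 then [seq rcons w i | w <- words m l', i <- enum 'I_m] else [:: [::]].

Lemma mem_words m l (w : seq 'I_m) : (w \in words m l) = (size w == l).
Proof.
elim: l w => [|l IH] w; first by rewrite inE size_eq0.
apply/allpairsP/eqP => [[[v i] /= [+ _ ->]]|].
  by rewrite IH size_rcons => /eqP->.
case/lastP: w => // w i; rewrite size_rcons => -[e].
by exists (w, i); rewrite /= IH e eqxx mem_enum.
Qed.

Section Dimension.
Variable R : realType.

Lemma powR_itv01 (x s : R) : 0 < x < 1 -> 0 < s -> 0 < x `^ s < 1.
Proof.
move=> /andP[x0 x1] s0; rewrite powR_gt0//= -[ltRHS](congr1 (@^~ s) (powR1 R)).
by apply: (gt0_ltr_powR s0); rewrite ?nnegrE ?ltW.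
Qed.

Lemma sum1_inhabited m (g : 'I_m -> R) : \sum_i g i = 1 -> exists i : 'I_m, True.
Proof.
move=> sum1; apply: contrapT => no; have := oner_neq0 R.
by rewrite -sum1 big1 ?eqxx// => i _; case: no; exists i.
Qed.

Lemma scale_wprod m (r : 'I_m -> R) s l : scale r s l = wprod r (mkseq s l).
Proof.
elim: l => [|l IH]; first by rewrite /scale /wprod big_ord0 big_nil.
by rewrite scaleS mkseqS wprod_rcons IH.
Qed.

Lemma wprod_powR m (r : 'I_m -> R) t u : (forall i, 0 < r i) ->
  wprod (fun i => r i `^ t) u = wprod r u `^ t.
Proof.
move=> r0; elim/last_ind: u => [|u i IH]; first by rewrite /wprod !big_nil powR1.
by rewrite !wprod_rcons IH powRM ?ltW ?wprod_gt0.
Qed.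

Lemma wprod_words m (g : 'I_m -> R) l : \sum_(u <- words m l) wprod g u = (\sum_i g i) ^+ l.
Proof.
elim: l => [|l IH]; first by rewrite big_seq1 /wprod big_nil.
rewrite /= big_allpairs_dep exprSr -IH mulr_suml; apply: eq_bigr => u _.
by rewrite big_enum mulr_sumr; apply: eq_bigr => i _; rewrite wprod_rcons.
Qed.

Lemma wprod_small m (r : 'I_m -> R) e : (forall i, 0 < r i < 1) -> 0 < e ->
  exists l, forall u, size u = l -> wprod r u <= e.
Proof.
move=> r01 e0.
have [c c0 hc] : exists2 c : R, 0 < c & forall i, r i <= 1 - c.
  apply: uniform_bound => [i c c' le h|i]; first by apply: le_trans h _; lra.
  by exists (1 - r i); have := r01 i; lra.
(* The maximum with 0 covers the case of an empty index type. *)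
pose rho := Num.max 0 (1 - c).
have rho0 : 0 <= rho by rewrite le_max lexx.
have rho1 : `|rho| < 1 by rewrite ger0_norm// gt_max ltr01/=; lra.
have /cvgrPdist_lt/(_ _ e0)[l _ /(_ l (leqnn l))] :
    GRing.exp rho @ \oo --> (0 : R) by exact: cvg_expr.
rewrite /= sub0r normrN ger0_norm ?exprn_ge0// => lte.
exists l => u su; apply: le_trans (ltW lte); rewrite -su.
elim/last_ind: u {su} => [|u i IH]; first by rewrite /wprod big_nil.
rewrite wprod_rcons size_rcons exprSr ler_pM//.
- by apply/ltW/wprod_gt0 => j; case/andP: (r01 j).
- by apply: ltW; case/andP: (r01 i).
- by rewrite le_max hc orbT.
Qed.

Lemma ediam_le n (U : set 'rV[R]_n) a : 0 <= a ->
  (forall x y, U x -> U y -> edist x y <= a) -> (ediam U <= a%:E)%E.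
Proof.
move=> a0 h; rewrite /ediam ge_max lee_fin a0/=.
by apply: ge_ereal_sup => _ [x Ux [y Uy <-]]; rewrite lee_fin h.
Qed.

Lemma ediam_ge0 n (U : set 'rV[R]_n) : (0 <= ediam U)%E.
Proof. by rewrite /ediam le_max lexx. Qed.

Lemma edist_le_ediam n (U : set 'rV[R]_n) x y : U x -> U y -> ((edist x y)%:E <= ediam U)%E.
Proof.
move=> Ux Uy; rewrite /ediam le_max; apply/orP; right.
by apply: ereal_sup_ubound; exists x => //; exists y.
Qed.

Lemma diam_pow_ge0 n t (U : set 'rV[R]_n) : (0 <= diam_pow t U)%E.
Proof. by rewrite /diam_pow; case: ifP => // _; exact: poweR_ge0. Qed.

Lemma diam_pow_le n t (U : set 'rV[R]_n) a : 0 <= t -> 0 <= a ->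
  (ediam U <= a%:E)%E -> (diam_pow t U <= (a `^ t)%:E)%E.
Proof.
move=> t0 a0 le; rewrite /diam_pow; case: ifP => _; first by rewrite lee_fin powR_ge0.
rewrite -poweR_EFin; apply: gt0_ler_poweR => //.
  by rewrite in_itv/= ediam_ge0 leey.
by rewrite in_itv/= leey lee_fin a0.
Qed.

Lemma nneseries_term (u : nat -> \bar R) k : (forall n, 0 <= u n)%E ->
  (u k <= \sum_(0 <= i <oo) u i)%E.
Proof.
move=> u0; apply: le_trans (nneseries_lim_ge k.+1 (fun n _ _ => u0 n)).
by rewrite big_nat_recr//= leeDr// sume_ge0.
Qed.

Lemma hausdorff_measure_ge0 n t (E : set 'rV[R]_n) : (0 <= hausdorff_measure t E)%E.
Proof.
apply: le_ereal_sup_tmp; exists (hausdorff_premeasure t 1 E); first by exists 1 => //; exact: ltr01.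
apply: le_ereal_inf_tmp => _ [U _ <-]; apply: nneseries_ge0 => k _ _.
exact: diam_pow_ge0.
Qed.

Variables (n m : nat) (K : set 'rV[R]_n) (r : 'I_m -> R) (ad : 'rV[R]_n -> nat -> 'I_m).
Hypotheses (codK : coding K r ad) (r01 : forall i, 0 < r i < 1).

Let r_gt0 i : 0 < r i. Proof. by case/andP: (r01 i). Qed.

Definition cylinder u := [set x | K x /\ mkseq (ad x) (size u) = u].

(** The cylinders of level [l] cover [K], and their weights add up to at most [D ^ t theta ^ l],
    which tends to 0. *)
Lemma hausdorff_measure_eq0 t : 0 < t -> \sum_i r i `^ t < 1 -> hausdorff_measure t K = 0%E.
Proof.
move=> t0 sum1; apply/eqP; rewrite eq_le hausdorff_measure_ge0 andbT.
apply: ge_ereal_sup => _ [delta /= d0 <-].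
apply/lee_addgt0Pr => e e0; rewrite add0e.
have [[D D0 hD] _ _] := codK.
set theta := \sum_i r i `^ t in sum1.
have theta0 : 0 <= theta by apply: sumr_ge0 => i _; exact: powR_ge0.
have small : exists2 l, D `^ t * theta ^+ l <= e & forall u, size u = l -> D * wprod r u <= delta.
  have [l1 h1] := wprod_small r01 (divr_gt0 d0 D0).
  have [l2 h2] : exists l2, theta ^+ l2 <= e / D `^ t.
    have ed0 : 0 < e / D `^ t by rewrite divr_gt0 ?powR_gt0.
    have /cvgrPdist_lt/(_ _ ed0)[l _ /(_ l (leqnn l))] :
      GRing.exp theta @ \oo --> (0 : R) by apply: cvg_expr; rewrite ger0_norm.
    by rewrite /= sub0r normrN ger0_norm ?exprn_ge0// => /ltW; exists l.
  (* [l1] makes the diameters small and [l2] the sum of weights; both persist at deeper levels. *)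
  exists (l1 + l2)%N.
    rewrite mulrC -ler_pdivlMr ?powR_gt0//; apply: le_trans h2.
    by rewrite exprD ler_piMl ?exprn_ge0// exprn_ile1// ltW.
  move=> u su; rewrite mulrC -ler_pdivlMr// -(cat_take_drop l1 u) wprod_cat.
  have le1 : wprod r (drop l1 u) <= 1.
    by apply: prodr_ile1 => i _; have /andP[/ltW-> /ltW->] := r01 i.
  apply: le_trans (ler_piMr (ltW (wprod_gt0 r_gt0 _)) le1) _; apply: h1.
  by rewrite size_takel// su leq_addr.
have [l le dl] := small.
pose W := words m l.
pose U k := if (k < size W)%N then cylinder (nth [::] W k) else set0.
have diamU u : u \in W -> (ediam (cylinder u) <= (D * wprod r u)%:E)%E.
  move=> uW; apply: ediam_le; first by rewrite mulr_ge0// ltW ?wprod_gt0.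
  move=> x y [Kx ex] [Ky ey]; rewrite -{1}ex -scale_wprod; apply: hD => //.
  by apply/agree_mkseq; rewrite ex ey.
have W_ u k : (k < size W)%N -> nth u W k \in W by exact: mem_nth.
apply: ge_ereal_inf; exists (\sum_(0 <= k <oo) diam_pow t (U k))%E; first exists U => //.
  split=> [x Kx|k].
    have xW : mkseq (ad x) l \in W by rewrite mem_words size_mkseq.
    exists (index (mkseq (ad x) l) W) => //; rewrite /U index_mem xW nth_index//.
    by split=> //; rewrite size_mkseq.
  rewrite /U; case: ifP => lt; last first.
    by apply: ediam_le; rewrite ?ltW// => x y [].
  apply: le_trans (diamU _ (W_ _ _ lt)) _; rewrite lee_fin dl//; apply/eqP.
  by rewrite -mem_words W_.
rewrite (nneseries_split 0 (size W)) ?add0n; last by move=> *; exact: diam_pow_ge0.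
rewrite [X in (_ + X)%E]eseries0 ?adde0; last first.
  move=> k le' _; rewrite /U ltnNge le'/= /diam_pow.
  by case: ifP => // /asboolP.
have -> : (\sum_(0 <= k < size W) diam_pow t (U k) = \sum_(u <- W) diam_pow t (cylinder u))%E.
  by rewrite (big_nth [::]); apply: eq_big_nat => k /andP[_ lt]; rewrite /U lt.
apply: (@le_trans _ _ (\sum_(u <- W) (D `^ t * wprod (fun i => r i `^ t) u)%:E)%E).
  rewrite big_seq [leRHS]big_seq; apply: lee_sum => u uW.
  have w0 : 0 <= wprod r u by rewrite ltW ?wprod_gt0.
  have -> : D `^ t * wprod (fun i => r i `^ t) u = (D * wprod r u) `^ t.
    by rewrite wprod_powR// powRM// ltW.
  by apply: diam_pow_le; rewrite ?diamU ?mulr_ge0// ltW.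
by rewrite sumEFin lee_fin -mulr_sumr wprod_words.
Qed.

(** * Lower bound for the dimension by the natural weights *)

Section Lower.
Variable s : R.
Hypothesis sum_s : \sum_i r i `^ s = 1.

Let p i := r i `^ s.

Let p_gt0 i : 0 < p i. Proof. exact: powR_gt0. Qed.

(* If the weights of the covering cylinders add up to less than 1, one can
   always descend to a child that is not exhausted by them. *)
Lemma cylinders_cover (g : nat -> seq 'I_m) :
  K `<=` \bigcup_k cylinder (g k) -> (1 <= \sum_(0 <= k <oo) (wprod p (g k))%:E)%E.
Proof.
move=> cover; rewrite leNgt; apply/negP => lt1.
(* [F u] below is the total weight of the covering cylinders contained in the cylinder [u]. The
   invariant of the descent is that it stays less than the weight of [u]. *)
pose h u k : \bar R := if prefix u (g k) then (wprod p (g k))%:E else 0%E.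
have h0 u k : (0 <= h u k)%E.
  by rewrite /h; case: ifP => // _; rewrite lee_fin ltW ?wprod_gt0.
pose F u := (\sum_(0 <= k <oo) h u k)%E.
have step u : (F u < (wprod p u)%:E)%E ->
    exists i, (F (rcons u i) < (wprod p (rcons u i))%:E)%E.
  move=> lt; apply: contrapT => no; move: lt; apply/negP; rewrite -leNgt.
  rewrite -(wprod_sum (p := p))// -sumEFin.
  apply: (@le_trans _ _ (\sum_i F (rcons u i))%E).
    by apply: lee_sum => i _; rewrite leNgt; apply/negP => lt; apply: no; exists i.
  rewrite -nneseries_sum//; apply: lee_nneseries => [k _ _|k _]; first exact: sume_ge0.
  have [pu|npu] := boolP (prefix u (g k)); last first.
    rewrite big1 ?h0// => i _; rewrite /h ifF//; apply: contraNF npu.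
    by apply: prefix_trans; exact: prefix_rcons.
  rewrite [leRHS]/h pu.
  have [[i pi]|no'] := pselect (exists i, prefix (rcons u i) (g k)); last first.
    rewrite big1 ?lee_fin ?ltW ?wprod_gt0// => i _; rewrite /h; case: ifP => // pi.
    by case: no'; exists i.
  rewrite (bigD1 i)//= big1 ?adde0; first by rewrite /h pi.
  move=> j /negP ji; rewrite /h ifF//; apply/negP; move: pi; rewrite !prefixE !size_rcons.
  by move=> /eqP-> /eqP/rcons_inj[ij]; apply: ji; rewrite ij.
have /choice[next nextP] : forall u, exists i, (F u < (wprod p u)%:E)%E ->
    (F (rcons u i) < (wprod p (rcons u i))%:E)%E.
  move=> u; have [lt|nlt] := pselect (F u < (wprod p u)%:E)%E.
    by have [i] := step u lt; exists i.
  have [_ _ surj] := codK.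
  have [i _] := sum1_inhabited sum_s.
  by exists i.
pose v l := iter l (fun u => rcons u (next u)) [::].
have Fv l : (F (v l) < (wprod p (v l))%:E)%E.
  elim: l => [|l IH]; last exact: nextP.
  rewrite /wprod big_nil; move: lt1; congr (_ < _)%E.
  by apply: eq_eseriesr => k _; rewrite /h prefix0s.
have vE l : v l = mkseq (fun j => next (v j)) l.
  by elim: l => // l IH; rewrite mkseqS -IH.
have [_ _ /(_ (fun j => next (v j)))[x Kx ex]] := codK.
(* The limit point [x] of the descent is covered by some [g k], which is thus one of the words
   [v l]. There [F] contains the full weight of the word, against the invariant. *)
have [k _ [_ ek]] := cover x Kx.
have gk : g k = v (size (g k)).
  by rewrite vE -{1}ek; apply/agree_mkseq => j _.
have := Fv (size (g k)); apply/negP; rewrite -leNgt -gk.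
apply: le_trans (nneseries_term k (h0 (g k))).
by rewrite /h prefix_refl.
Qed.

(** Replaces a covering set by a single cylinder at a bounded cost. The slack [e] pays for sets that
    miss [K] or have diameter 0. *)
Lemma cylinder_near t : 0 <= t -> t < s -> exists2 C : R, 0 < C &
  forall (U : set 'rV[R]_n) e, 0 < e -> (ediam U < +oo)%E ->
  exists u, U `&` K `<=` cylinder u /\ ((wprod p u)%:E <= C%:E * diam_pow t U + e%:E)%E.
Proof.
move=> t0 ts; have s0 : 0 < s by exact: le_lt_trans ts.
have [_ [c c0 hc] surj] := codK.
exists (c^-1 `^ t); first by rewrite powR_gt0 ?invr_gt0.
move=> U e e0 Ufin.
have [l lP] := wprod_small (fun i => powR_itv01 (r01 i) s0) e0.
have far u : (wprod p u <= e) ->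
    ((wprod p u)%:E <= (c^-1 `^ t)%:E * diam_pow t U + e%:E)%E.
  move=> le; apply: (@le_trans _ _ (0 + e%:E)%E); first by rewrite add0e lee_fin.
  by rewrite leeD2r// mule_ge0 ?diam_pow_ge0// lee_fin powR_ge0.
have [[x [Ux Kx]]|none] := pselect (U `&` K !=set0); last first.
  have [i _] := sum1_inhabited sum_s.
  exists (nseq l i); split; last by apply/far/lP; rewrite size_nseq.
  by move=> x UKx; case: none; exists x.
pose a := fine (ediam U).
have aE : ediam U = a%:E.
  by rewrite fineK// fin_numElt Ufin andbT (lt_le_trans _ (ediam_ge0 U))// ltNy0.
have a0 : 0 <= a by rewrite -lee_fin -aE ediam_ge0.
have inside k : (forall j, (j < k)%N -> a < c * scale r (ad x) j) ->
    U `&` K `<=` cylinder (mkseq (ad x) k).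
  move=> h y [Uy Ky]; split=> //; rewrite size_mkseq; apply/esym/agree_mkseq.
  apply: contrapT => /first_difference[j [lt ag ne]].
  have := h j lt; apply/negP; rewrite -leNgt.
  by rewrite (le_trans (hc x y j Kx Ky ag ne))// -lee_fin -aE edist_le_ediam.
(* Up to the first such [k], points of [U] cannot disagree with [x], since that would separate them
   by more than the diameter. If there is none, every prefix of [x] will do, and one of weight at
   most [e] is taken. *)
have [ex|no] := pselect (exists k, c * scale r (ad x) k <= a); last first.
  exists (mkseq (ad x) l); split; last by apply/far/lP; rewrite size_mkseq.
  by apply: inside => j _; rewrite ltNge; apply/negP => le; apply: no; exists j.
case: (ex_minnP ex) => k ka kmin; exists (mkseq (ad x) k); split.
  by apply: inside => j lt; rewrite ltNge; apply: contraTN lt => /kmin; rewrite -leqNgt.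
have w0 := wprod_gt0 r_gt0 (mkseq (ad x) k).
have wle : wprod r (mkseq (ad x) k) <= c^-1 * a.
  by rewrite -scale_wprod ler_pdivlMl.
apply: (@le_trans _ _ ((c^-1 `^ t)%:E * diam_pow t U)%E); last first.
  by rewrite leeDl// lee_fin ltW.
have -> : diam_pow t U = (a `^ t)%:E.
  rewrite /diam_pow ifF ?aE//; apply/asboolP => U0.
  by rewrite U0 in Ux.
rewrite lee_fin wprod_powR// -powRM ?invr_ge0 ?(ltW c0)//.
(* A base of at most 1 makes the power with exponent [s] at most the one with exponent [t]. *)
apply: (@le_trans _ _ (wprod r (mkseq (ad x) k) `^ t)).
  apply: ger_powR; last exact: ltW.
  rewrite w0/=; apply: prodr_ile1 => i _; have /andP[/ltW-> /ltW->] := r01 i.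
  by [].
apply: ge0_ler_powR => //; rewrite nnegrE; first exact: ltW.
by rewrite mulr_ge0// invr_ge0 ltW.
Qed.

Lemma hausdorff_measure_neq0 t : 0 <= t -> t < s -> hausdorff_measure t K <> 0%E.
Proof.
move=> t0 ts H0.
have [C C0 near] := cylinder_near t0 ts.
(* The cover contributes at most 1/4 after multiplication by [C], and the slacks add up to 1/4, so
   the cylinders have total weight less than 1. *)
have pre0 : (hausdorff_premeasure t 1 K < (C^-1 / 4)%:E)%E.
  apply: (@le_lt_trans _ _ 0%E); last by rewrite lte_fin divr_gt0 ?invr_gt0.
  by rewrite -H0; apply: ereal_sup_ubound; exists 1 => //; exact: ltr01.
have [_ [U [cov dU] <-] lt] := ereal_inf_lt pre0.
have /choice[u uP] : forall k, exists u, U k `&` K `<=` cylinder u /\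
    ((wprod p u)%:E <= C%:E * diam_pow t (U k) + (1 / 4 / (2 ^ k.+1)%:R)%:E)%E.
  move=> k; apply: near; last exact: le_lt_trans (dU k) (ltry _).
  by rewrite divr_gt0// ltr0n expn_gt0.
have : (1 <= \sum_(0 <= k <oo) (wprod p (u k))%:E)%E.
  apply: cylinders_cover => x Kx; have [k _ Ux] := cov x Kx.
  by exists k => //; apply: (uP k).1.
apply/negP; rewrite -ltNge.
apply: (@le_lt_trans _ _
    (\sum_(0 <= k <oo) (C%:E * diam_pow t (U k) + (1 / 4 / (2 ^ k.+1)%:R)%:E))%E).
  apply: lee_nneseries => [k _ _|k _]; last by case: (uP k).
  by rewrite lee_fin ltW ?wprod_gt0.
apply: le_lt_trans (epsilon_trick _ _ _) _ => //.
  by move=> k; rewrite mule_ge0 ?diam_pow_ge0// lee_fin ltW.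
rewrite nneseriesZl; last by move=> k _; exact: diam_pow_ge0.
apply: (@le_lt_trans _ _ ((1 / 4 : R)%:E + (1 / 4 : R)%:E)%E); last first.
  by rewrite -EFinD lte_fin; lra.
rewrite leeD2r//; apply: (@le_trans _ _ (C%:E * (C^-1 / 4)%:E)%E).
  by rewrite lee_pmul2l ?lte_fin// ltW.
by rewrite -EFinM lee_fin mulrA mulfV ?gt_eqF.
Qed.

Lemma hausdorff_dim_coding : 0 <= s -> hausdorff_dim K = s%:E.
Proof.
move=> s0; apply/eqP; rewrite eq_le; apply/andP; split; last first.
  apply: le_ereal_inf_tmp => _ [t [t0 Ht] <-]; rewrite lee_fin leNgt; apply/negP => ts.
  exact: (hausdorff_measure_neq0 t0 ts Ht).
apply/lee_addgt0Pr => e e0; apply: ereal_inf_lbound; exists (s + e) => //.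
split; first by rewrite addr_ge0// ltW.
apply: hausdorff_measure_eq0; first by rewrite ltr_wpDl.
rewrite -[ltRHS]sum_s.
have [i _] := sum1_inhabited sum_s.
have lt j : r j `^ (s + e) < r j `^ s.
  rewrite powRD; last by rewrite (gt_eqF (r_gt0 j)) implybT.
  by rewrite gtr_pMr ?powR_gt0//; case/andP: (powR_itv01 (r01 j) e0).
by apply: ltr_sum => //; apply/hasP; exists i; rewrite ?mem_index_enum.
Qed.

End Lower.
End Dimension.

(** * Lipschitz surjections *)

Section LipschitzSurjection.
Variable R : realType.

Lemma wprod_nseq k (p : 'I_k -> R) l i : wprod p (nseq l i) = p i ^+ l.
Proof. by rewrite /wprod big_nseq; elim: l => //= l ->; rewrite exprS. Qed.

(** Intermediate value theorem: the sum is [m] at exponent 0, and at most 1 once every [r i ^ l] is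
    at most [1 / m]. *)
Lemma similarity_exponent m (r : 'I_m -> R) : (0 < m)%N -> (forall i, 0 < r i < 1) ->
  exists2 s, 0 <= s & \sum_i r i `^ s = 1.
Proof.
move=> m0 r01; have mR : 0 < m%:R :> R by rewrite ltr0n.
have minv : 0 < m%:R^-1 :> R by rewrite invr_gt0.
have [l lP] := wprod_small r01 minv.
have g0 : \sum_i r i `^ 0 = m%:R.
  by under eq_bigr do rewrite powRr0; rewrite sumr_const card_ord.
have gl : \sum_i r i `^ l%:R <= 1.
  apply: (@le_trans _ _ (\sum_(i < m) m%:R^-1)).
    apply: ler_sum => i _; rewrite powR_mulrn; last by case/andP: (r01 i) => /ltW.
    by rewrite -wprod_nseq; apply: lP; rewrite size_nseq.
  by rewrite sumr_const card_ord -[_ *+ m]mulr_natl mulfV// gt_eqF.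
have cont : continuous (fun s => \sum_i r i `^ s).
  apply: continuous_big => [|i _]; first exact: add_continuous.
  have -> : powR (r i) = expR \o (fun s => s * ln (r i)).
    by apply/funext => s; rewrite /powR gt_eqF//; case/andP: (r01 i).
  by move=> s; apply: continuous_comp; [exact: mulrr_continuous | exact: continuous_expR].
have [|||s + gs] := @IVT R (fun s => \sum_i r i `^ s) 0 l%:R 1.
- exact: ler0n.
- exact: continuous_subspaceT.
- rewrite g0; apply/andP; split; first by rewrite ge_min gl orbT.
  by rewrite le_max ler1n m0.
by rewrite in_itv/= => /andP[s0 _]; exists s.
Qed.

(** * The mass that a Lipschitz surjection pushes onto the cylinders of the target *)

Section Counting.
Variables (n d m k : nat) (A : set 'rV[R]_n) (B : set 'rV[R]_d) (r : R) (rB : 'I_k -> R).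
Variables (ad : 'rV[R]_n -> nat -> 'I_m) (bd : 'rV[R]_d -> nat -> 'I_k).
Variables (f : 'rV[R]_n -> 'rV[R]_d) (s : R).
Hypotheses (cA : coding A (fun=> r) ad) (cB : coding B rB bd).
Hypotheses (r0 : 0 < r) (rB01 : forall i, 0 < rB i < 1).
Hypotheses (m2 : (1 < m)%N) (s0 : 0 < s) (rs : m%:R * r `^ s = 1).
Hypothesis rBs : \sum_i rB i `^ s = 1.
Hypotheses (fA : f @` A = B) (f_lip : lipschitz_in A f).

Let p i := rB i `^ s.

Let p_gt0 i : 0 < p i.
Proof. by apply: powR_gt0; case/andP: (rB01 i). Qed.

Let p_le1 i : p i <= 1.
Proof. by rewrite -rBs (bigD1 i)//= lerDl sumr_ge0// => j _; exact: powR_ge0. Qed.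

Let wp_gt0 u : 0 < wprod p u. Proof. exact: wprod_gt0. Qed.

Let wprod_le1 u : wprod p u <= 1.
Proof. by apply: prodr_ile1 => i _; rewrite ltW ?p_le1. Qed.

Let wprod_cat_le u v : wprod p (u ++ v) <= wprod p u.
Proof. by rewrite wprod_cat ler_piMr// ltW. Qed.

Let m_gt0 : 0 < m%:R :> R. Proof. by rewrite ltr0n ltnW. Qed.

Let m_exp_gt0 l : 0 < m%:R ^+ l :> R. Proof. exact: exprn_gt0. Qed.

(** The image of a level-[l] cylinder has diameter at most a multiple of [r ^ l], and
    [r ^ s = 1 / m]. A first difference at index [i] forces a distance governed by the first [i]
    digits only, so a bound on the weight of [j] digits fixes [j.+1] of them. *)
Lemma digits_determined : exists2 L : R, 0 < L & forall a a' l j, A a -> A a' ->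
  agree l (ad a) (ad a') -> L / m%:R ^+ l < wprod p (mkseq (bd (f a)) j) ->
  agree j.+1 (bd (f a)) (bd (f a')).
Proof.
have [C hC] := f_lip; have [[D D0 hD] _ _] := cA; have [_ [c c0 hc] _] := cB.
(* A Lipschitz constant [C] need not be positive. *)
pose C' := Num.max C 1; have C'0 : 0 < C' by rewrite lt_max ltr01 orbT.
exists ((C' * D / c) `^ s); first by rewrite powR_gt0// divr_gt0// mulr_gt0.
move=> a a' l j Aa Aa' ag lt; apply: contrapT => /first_difference[i [ltij ag' ne]].
have B_ x : A x -> B (f x) by move=> Ax; rewrite -fA; exists x.
have le1 : scale rB (bd (f a)) i <= C' * D / c * r ^+ l.
  rewrite mulrAC ler_pdivlMr// mulrC; apply: le_trans (hc _ _ _ (B_ _ Aa) (B_ _ Aa') ag' ne) _.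
  apply: le_trans (hC _ _ Aa Aa') _; rewrite -mulrA.
  apply: (@le_trans _ _ (C' * edist a a')).
    by rewrite ler_wpM2r ?edist_ge0// le_max lexx.
  rewrite ler_pM2l//; apply: le_trans (hD _ _ _ Aa Aa' ag) _.
  by rewrite /scale prodr_const card_ord.
move: lt; apply/negP; rewrite -leNgt.
have pre : wprod p (mkseq (bd (f a)) j) <= wprod p (mkseq (bd (f a)) i).
  rewrite -(subnKC (_ : i <= j)%N)// /mkseq iotaD map_cat; exact: wprod_cat_le.
apply: le_trans pre _; rewrite wprod_powR; last by move=> t; case/andP: (rB01 t).
rewrite -scale_wprod.
have -> : (m%:R ^+ l)^-1 = (r ^+ l) `^ s.
  rewrite -powR_mulrn ?(ltW r0)// powRAC powR_mulrn ?powR_ge0// -exprVn; congr (_ ^+ _).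
  by apply: (mulfI (lt0r_neq0 m_gt0)); rewrite rs mulfV ?gt_eqF.
have CD0 : 0 <= C' * D / c by rewrite ltW// divr_gt0// mulr_gt0.
rewrite -powRM ?exprn_ge0 ?(ltW r0)//; apply: ge0_ler_powR => //; first exact: ltW.
  by rewrite nnegrE; apply/ltW/scale_gt0 => t; case/andP: (rB01 t).
by rewrite nnegrE mulr_ge0// exprn_ge0// ltW.
Qed.

Lemma weights_bounded_ratio : exists K : nat, forall w, exists N1 N2 j : nat,
  [/\ (0 < N1 <= K)%N, (0 < N2 <= K)%N & wprod p w * N1%:R * m%:R ^+ j = N2%:R].
Proof.
have [L L0 detL] := digits_determined.
have i0 : 'I_m := Ordinal (ltnW m2).
have [pa Apa pad] := coding_point cA; have [pb Bpb pbd] := coding_point cB.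
pose pt v := pa (fun j => nth i0 v j).
(* [N l w] counts the cylinders of level [l] of [A] that [f] maps into the
   cylinder [w] of [B], which is meaningful if [padm l w], because then the first
   [l] digits of [a] decide whether [f a] lies in [w]. *)
pose inc w a := mkseq (bd (f a)) (size w) == w.
(* [adm l u] makes level [l] resolve one digit more than [u] has. So to resolve [w] it suffices that
   its parent is admissible, which is [padm], and all children of [u] can be counted at the level of
   [u]. *)
pose adm l u := L / m%:R ^+ l < wprod p u.
pose padm l w := adm l (take (size w).-1 w).
pose N l w := count (fun v => inc w (pt v)) (words m l).
have inc_agree l w a a' : padm l w -> A a -> A a' -> agree l (ad a) (ad a') ->
    inc w a = inc w a'.
  suff W a1 a2 : padm l w -> A a1 -> A a2 -> agree l (ad a1) (ad a2) ->
      inc w a1 -> inc w a2.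
    by move=> *; apply/idP/idP; apply: W => //; move=> j lt; apply/esym; auto.
  move=> pw Aa Aa' ag /eqP e; rewrite /inc -{2}e; apply/eqP/esym/agree_mkseq.
  have le : (size w <= (size w).-1.+1)%N by exact: leqSpred.
  apply: (agree_leq le); apply: detL ag _ => //.
  have -> // : mkseq (bd (f a1)) (size w).-1 = take (size w).-1 w.
  by rewrite -{3}e /mkseq -map_take take_iota (minn_idPl (leq_pred _)).
have pt_agree v w l : size v = l -> agree l (ad (pt v)) (ad (pt (v ++ w))).
  by move=> <- j lt; rewrite !pad nth_cat lt.
have N_step l w : padm l w -> N l.+1 w = (m * N l w)%N.
  move=> pw; rewrite /N -!sum1_count big_mkcond [in RHS]big_mkcond/= big_allpairs_dep big_distrr/=.
  rewrite big_seq [RHS]big_seq; apply: eq_bigr => v; rewrite mem_words => /eqP sv.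
  rewrite big_enum/= (eq_bigr (fun=> if inc w (pt v) then 1 else 0)%N).
    by rewrite sum_nat_const card_ord.
  move=> i _; rewrite -cats1 (inc_agree l w (pt v) (pt (v ++ [:: i])))//.
  - exact: Apa.
  - exact: Apa.
  - exact: pt_agree.
have admS l l' u : (l <= l')%N -> adm l u -> adm l' u.
  move=> le; apply: le_lt_trans; rewrite ler_pM2l// lef_pV2 ?posrE//.
  by rewrite ler_eXn2l// ltr1n.
have N_iter l l' w : (l <= l')%N -> padm l w ->
    (N l' w)%:R / m%:R ^+ l' = (N l w)%:R / m%:R ^+ l :> R.
  move=> /subnK <- pw; elim: (l' - l)%N => // e IH.
  rewrite addSn N_step; last by apply: admS pw; exact: leq_addl.
  rewrite -IH natrM exprS; field; by rewrite expf_neq0 ?gt_eqF.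
(* Surjectivity enters here: some point of the cylinder [w] is an image [f a], and the level-[l]
   cylinder of [a] is counted. *)
have N_gt0 l w : padm l w -> (0 < N l w)%N.
  move=> pw; rewrite -has_count.
  have [k0 _] := sum1_inhabited rBs.
  have : B (pb (fun j => nth k0 w j)) by exact: Bpb.
  rewrite -{1}fA => -[a Aa fa]; apply/hasP; exists (mkseq (ad a) l).
    by rewrite mem_words size_mkseq.
  rewrite (inc_agree l w _ a)//; last first.
  - by move=> j lt; rewrite pad nth_mkseq.
  - exact: Apa.
  apply/eqP/(@eq_from_nth _ k0); rewrite size_mkseq// => j lt.
  by rewrite nth_mkseq// fa pbd.
have N_children l u : (\sum_i N l (rcons u i) = N l u)%N.
  rewrite /N -[RHS]sum1_count [RHS]big_mkcond/=.
  under eq_bigr do rewrite -sum1_count big_mkcond/=.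
  rewrite exchange_big/=; apply: eq_bigr => v _.
  have incE i : inc (rcons u i) (pt v) = inc u (pt v) && (bd (f (pt v)) (size u) == i).
    by rewrite /inc size_rcons mkseqS eqseq_rcons.
  have [iu|niu] := boolP (inc u (pt v)); last first.
    by rewrite big1// => i _; rewrite incE (negbTE niu).
  rewrite (bigD1 (bd (f (pt v)) (size u)))//= incE iu eqxx big1// => i ne.
  by rewrite incE eq_sym (negbTE ne) andbF.
have ex_adm u : exists l, adm l u.
  exists (Num.bound (L / wprod p u)).
  rewrite /adm ltr_pdivrMr// mulrC -ltr_pdivrMr//.
  apply: lt_trans (archi_boundP _) _; first by rewrite divr_ge0// ltW.
  by rewrite -natrX ltr_nat ltn_expl.
(* The least admissible level: admissibility gives the lower bound [L] for [m ^ lev u] times the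
   weight, minimality the upper bound [m L], or 1 at level 0. *)
have /choice[lev levP] : forall u, exists l, adm l u /\ forall l', adm l' u -> (l <= l')%N.
  by move=> u; case: (ex_minnP (ex_adm u)) => l; exists l.
have lev_adm u : adm (lev u) u by case: (levP u).
have adm_padm l w : adm l w -> padm l w.
  move=> a; apply: lt_le_trans a _; rewrite -{1}(cat_take_drop (size w).-1 w).
  exact: wprod_cat_le.
have parentE u i : take (size (rcons u i)).-1 (rcons u i) = u.
  by rewrite size_rcons/= -cats1 take_size_cat.
have lev_mono u i : (lev u <= lev (rcons u i))%N.
  by apply: (levP u).2; have := adm_padm _ _ (lev_adm (rcons u i)); rewrite /padm parentE.
apply: (@bounded_ratio R k m p m2 p_gt0 rBs (fun u => N (lev u) u) lev L (1 + m%:R * L)) => //.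
- by move=> u; apply/N_gt0/adm_padm.
- move=> u; rewrite -N_children natr_sum mulr_suml; apply: eq_bigr => i _.
  by apply: N_iter => //; rewrite /padm parentE.
- by move=> u; have /ltW := lev_adm u; rewrite ler_pdivrMr// mulrC.
move=> u; case E: (lev u) => [|l].
  by rewrite mul1r (le_trans (wprod_le1 u))// lerDl mulr_ge0 ?ltW.
have : ~ adm l u by move=> /(levP u).2; rewrite E ltnn.
move=> /negP; rewrite -leNgt ler_pdivlMr// => le.
apply: (@le_trans _ _ (m%:R * L)); last by rewrite lerDr.
by rewrite exprS -mulrA ler_pM2l// mulrC.
Qed.

End Counting.

(** * Passage to streams over a common alphabet *)

Lemma kraft_inverse (q k : nat) (b : 'I_k -> nat) : (0 < q)%N ->
  \sum_i (q%:R ^+ b i)^-1 = 1 :> R ->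
  exists c : 'I_k -> seq 'I_q, (forall i, size (c i) = b i) /\
    forall s, exists i, forall j, is_prefix (c j) s = (j == i).
Proof.
move=> q0 sum1; pose M := \max_i b i.
have le i : (b i <= M)%N by exact: leq_bigmax.
apply: (@kraft _ k M) => //; apply/eqP; rewrite -(eqr_nat R) natr_sum natrX.
rewrite -[X in _ == X]mulr1 -[X in _ * X]sum1 mulr_sumr; apply/eqP; apply: eq_bigr => i _.
by rewrite natrX expfB_cond// pnatr_eq0 (gtn_eqF q0) le.
Qed.

Lemma root_itv01 (q : nat) (s : R) : (1 < q)%N -> 0 < s -> 0 < q%:R^-1 `^ s^-1 < 1.
Proof.
move=> q1 s0; have qR : 0 < q%:R :> R by rewrite ltr0n ltnW.
by apply: powR_itv01; rewrite invr_gt0// qR invf_lt1// ltr1n.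
Qed.

(** Each ratio is [rho ^ b i] with [rho = q ^ (- 1 / s)], so the symbol [i] is replaced by a code
    word of length [b i]. *)
Lemma coding_power n m (K : set 'rV[R]_n) (r : 'I_m -> R) ad (q : nat) (b : 'I_m -> nat) s :
  coding K r ad -> (forall i, 0 < r i) -> 0 < s -> (1 < q)%N -> (forall i, (0 < b i)%N) ->
  (forall i, r i `^ s = (q%:R ^+ b i)^-1) -> \sum_i (q%:R ^+ b i)^-1 = 1 :> R ->
  exists ad', coding K (fun=> q%:R^-1 `^ s^-1) (ad' : _ -> nat -> 'I_q).
Proof.
move=> cK r0 s0 q1 b0 rE sum1.
have qR : 0 < q%:R :> R by rewrite ltr0n ltnW.
have [c [sc cc]] := kraft_inverse (ltnW q1) sum1.
exists (concat (Ordinal (ltnW q1)) c \o ad); apply: coding_concat => //.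
- by move=> i; rewrite sc.
- exact: root_itv01.
suff <- : r = fun i => (q%:R^-1 `^ s^-1) ^+ size (c i) by [].
apply/funext => i; rewrite sc -powR_mulrn ?powR_ge0// powRAC.
rewrite powR_mulrn ?invr_ge0 ?(ltW qR)// exprVn -rE -powRrM mulfV ?gt_eqF//.
by rewrite powRr1// ltW.
Qed.

Lemma coding_singleton n (K : set 'rV[R]_n) (r : 'I_1 -> R) ad :
  coding K r ad -> 0 < r ord0 < 1 -> exists x, K = [set x].
Proof.
move=> cK r01; have [_ _ /(_ (fun=> ord0))[x Kx _]] := cK.
have rE : r = fun=> r ord0 by apply/funext => i; rewrite ord1.
rewrite rE in cK; exists x; apply/seteqP; split=> [y Ky|y ->//].
by apply: (coding_inj r01 cK) => // j; rewrite !ord1.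
Qed.

Lemma bilipschitz_singletons n k (x : 'rV[R]_n) (y : 'rV[R]_k) :
  bilipschitz_equivalent [set x] [set y].
Proof.
exists (fun=> y), (fun=> x); split.
- split=> [z _ //|z w|z ->]; last by exists x.
  by rewrite !inE => -> ->.
- by move=> z ->.
- by exists 0 => z w _ _; rewrite edist_xx mul0r.
- by exists 0 => z w _ _; rewrite edist_xx mul0r.
Qed.

End LipschitzSurjection.

Theorem theorem1p17 (R : realType) (n k : nat)
    (A : set 'rV[R]_n) (B : set 'rV[R]_k)
    (hA : homogeneous_self_similar_SSC A) (hB : self_similar_SSC B)
    (hdim : hausdorff_dim A = hausdorff_dim B) :
  lipschitz_onto A B <-> bilipschitz_equivalent A B.
Proof.
split; last first.
  move=> [f [g [[fAB _ surj] _ lf _]]]; exists f; split=> //.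
  by apply/seteqP; split=> [_ [x Ax <-]|y By]; [exact: fAB | exact: surj].
move=> [f [fA f_lip]].
case: hA => m [F [[_ A0 cptA AE] sscA [r r01 simF]]].
case: hB => l [G [[contrG B0 cptB BE] sscB]].
have /choice[rB rBP] : forall i, exists r : R, 0 < r < 1 /\ similarity r (G i).
  by move=> i; have [r'] := contrG i; exists r'.
have rB01 i : 0 < rB i < 1 by case: (rBP i).
have rB0 i : 0 < rB i by case/andP: (rB01 i).
have /andP[r0 r1] := r01.
have [ad cA] := @coding_exists R n m F (fun=> r) A (fun=> r0) simF A0 cptA AE sscA.
have [bd cB] := coding_exists rB0 (fun i => (rBP i).2) B0 cptB BE sscB.
have m0 : (0 < m)%N.
  by case: A0 => x; rewrite AE => -[i _ _]; exact: leq_ltn_trans (leq0n _) (ltn_ord i).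
have l0 : (0 < l)%N.
  by case: B0 => x; rewrite BE => -[i _ _]; exact: leq_ltn_trans (leq0n _) (ltn_ord i).
have [s s0 sumA] := @similarity_exponent R m (fun=> r) m0 (fun=> r01).
have [s' s'0 sumB] := similarity_exponent l0 rB01.
(* Both similarity exponents equal the Hausdorff dimension. *)
have es : s = s'.
  move: hdim; rewrite (hausdorff_dim_coding cA (fun=> r01) sumA s0).
  by rewrite (hausdorff_dim_coding cB rB01 sumB s'0) => -[].
subst s'; rewrite sumr_const card_ord in sumA.
(* With a single map the exponent is 0, so [B] has a single map too and both sets are points. *)
have [m1|m2] := leqP m 1.
  have em : m = 1%N by apply/eqP; rewrite eqn_leq m1 m0.
  have es : s = 0.
    move: sumA; rewrite em mulr1n => /eqP; rewrite powR_eq1 (lt_eqF r1)/=.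
    by rewrite ltNge (ltW r0)/= => /eqP.
  have el : l = 1%N.
    move: sumB; rewrite es; under eq_bigr do rewrite powRr0.
    by rewrite sumr_const card_ord => /eqP; rewrite -[1%R]/(1%:R) eqr_nat => /eqP.
  subst m l.
  have [x ->] := coding_singleton cA r01; have [y ->] := coding_singleton cB (rB01 ord0).
  exact: bilipschitz_singletons.
have sgt0 : 0 < s.
  rewrite lt_neqAle s0 andbT; apply/eqP => es; move: sumA; rewrite -es powRr0 => /eqP.
  by rewrite -[1]/(1%:R) eqr_nat; case: (m) m2 => [|[]].
have rs : m%:R * r `^ s = 1 by rewrite mulr_natl.
have mR : m%:R != 0 :> R by rewrite pnatr_eq0 -lt0n.
have [K HK] := weights_bounded_ratio cA cB r0 rB01 m2 sgt0 rs sumB fA f_lip.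
have /choice[c cP] : forall i, exists c : nat,
    [/\ (1 < c)%N, mult_dep c m & rB i `^ s = c%:R^-1].
  move=> i; apply: (@inverse_mult_dep R m (rB i `^ s) K m2).
    exact: powR_itv01.
  (* The weights of constant words are the powers of a single weight. *)
  move=> j; have [N1 [N2 [e [h1 h2 h3]]]] := HK (nseq j i).
  by exists N1, N2, e; split=> //; rewrite -h3 wprod_nseq.
have [q [q1 qP]] := common_root_family m2.
have [t t0 mE] : exists2 t, (0 < t)%N & m = (q ^ t)%N.
  by apply: qP => //; exists 1%N, 1%N.
have /choice[b bP] : forall i, exists b, (0 < b)%N /\ c i = (q ^ b)%N.
  by move=> i; have [h1 h2 _] := cP i; have [b] := qP _ h1 h2; exists b.
have rE : r `^ s = (q%:R ^+ t)^-1.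
  by apply: (mulfI mR); rewrite rs -natrX -mE mulfV.
have rBE i : rB i `^ s = (q%:R ^+ b i)^-1.
  by have [_ _ ->] := cP i; rewrite (bP i).2 natrX.
(* Homogeneity gives all code words of [A] the same length [t]; those of [B] have the lengths [b i].
   The resulting alphabet and ratio are common to both. *)
have [ad' cA'] : exists ad', coding A (fun=> q%:R^-1 `^ s^-1) (ad' : _ -> nat -> 'I_q).
  apply: (@coding_power R n m A (fun=> r) ad q (fun=> t) s) => //.
  by rewrite -rE sumr_const card_ord.
have [bd' cB'] : exists bd', coding B (fun=> q%:R^-1 `^ s^-1) (bd' : _ -> nat -> 'I_q).
  apply: (@coding_power R k l B rB bd q b s) => //; first by move=> i; case: (bP i).
  by rewrite -[RHS]sumB; apply: eq_bigr => i _; rewrite rBE.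
by apply: coding_bilipschitz cA' cB'; exact: root_itv01.
Qed.
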